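(* Let $m\ge1$, $1\leq p<2$, $0\le\alpha\le1$, $\nu\in\{0,1,2,\dots\}$, and let $\varphi\in C^{\nu,\alpha}(\mathbb T^m)$ be a real function. Suppose $\nu+\alpha\geq1$ and $\nu+\alpha>m(1/p-1/2)$. Then $$\|e^{i\lambda\varphi}\|_{A_p(\mathbb T^m)}=O\big(|\lambda|^{m(1/p-1/2)}\big),\qquad |\lambda|\to\infty,\ \lambda\in\mathbb R.$$
   Context: $\mathbb T^m=\mathbb R^m/2\pi\mathbb Z^m$; functions on $\mathbb T^m$ are identified with $2\pi$-periodic functions on $\mathbb R^m$. $\widehat f(k)=(2\pi)^{-m}\int_{\mathbb T^m}f(t)e^{-i(k,t)}dt$; $A_1(\mathbb T^m)$ is the space of continuous $f$ with $\widehat f\in l^1(\mathbb Z^m)$, for $1<p\le2$ $A_p(\mathbb T^m)$ is the space of integrable $f$ with $\widehat f\in l^p$; $\|f\|_{A_p(\mathbb T^m)}=\|\widehat f\|_{l^p(\mathbb Z^m)}$. For $0<\alpha\le1$, $C^{\nu,\alpha}(\mathbb T^m)$ is the class of $\nu$ times differentiable functions on $\mathbb T^m$ all of whose partial derivatives of order $\nu$ (for $\nu=0$, the function itself) satisfy a Lipschitz condition of order $\alpha$; $C^{\nu,0}(\mathbb T^m)=C^\nu(\mathbb T^m)$, the class of functions whose partial derivatives of order $\nu$ are continuous. *)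

(* Defs.v *)
From mathcomp Require Import ssreflect ssrbool ssrfun eqtype ssrnat seq choice fintype finfun bigop.
From Stdlib Require Import Reals.
From Coquelicot Require Import Coquelicot.


Local Open Scope R_scope.

(* Points of R^m (2pi-periodic functions on R^m = functions on T^m). *)
Definition pt (m : nat) := 'I_m -> R.

Definition upd {m} (x : pt m) (i : 'I_m) (s : R) : pt m :=
  fun j => if j == i then s else x j.

(* real power with the convention 0^a = 0 (Stdlib's Rpower 0 a = 1) *)
Definition rpow (x a : R) : R :=
  match Rle_dec x 0 with left _ => 0 | right _ => Rpower x a end.

Definition dist {m} (x y : pt m) : R :=
  sqrt (\big[Rplus/0]_(j < m) (x j - y j) ^ 2).

Definition periodic {m} (f : pt m -> R) : Prop :=
  forall (x : pt m) (i : 'I_m), f (upd x i (x i + 2 * PI)) = f x.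

Definition continuous_m {m} (f : pt m -> R) : Prop :=
  forall (x : pt m) (eps : R), 0 < eps -> exists delta, 0 < delta /\
    forall y : pt m, dist y x < delta -> Rabs (f y - f x) < eps.

Definition partial {m} (i : 'I_m) (f : pt m -> R) : pt m -> R :=
  fun x => Derive (fun s => f (upd x i s)) (x i).

Definition ex_partial {m} (i : 'I_m) (f : pt m -> R) : Prop :=
  forall x : pt m, ex_derive (fun s => f (upd x i s)) (x i).

Definition Dseq {m} (ix : seq 'I_m) (f : pt m -> R) : pt m -> R :=
  foldr (fun i g => partial i g) f ix.

Definition C_nu_alpha (m nu : nat) (alpha : R) (f : pt m -> R) : Prop :=
  periodic f /\
  (forall ix : seq 'I_m, (ltn (size ix) nu) -> forall i, ex_partial i (Dseq ix f)) /\
  (forall ix : seq 'I_m, (leq (size ix) nu) -> continuous_m (Dseq ix f)) /\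
  (0 < alpha -> exists K, forall ix : seq 'I_m, size ix = nu ->
     forall x y : pt m, Rabs (Dseq ix f x - Dseq ix f y) <= K * rpow (dist x y) alpha).

Definition iint {m} (ix : seq 'I_m) (F : pt m -> R) : pt m -> R :=
  foldr (fun i G => fun x => RInt (fun s => G (upd x i s)) 0 (2 * PI)) F ix.

Definition integral_T {m} (F : pt m -> R) : R :=
  iint (enum 'I_m) F (fun _ => 0).

Definition kdot {m} (k : 'I_m -> Z) (t : pt m) : R :=
  \big[Rplus/0]_(j < m) (IZR (k j) * t j).

(* Fourier coefficient of the complex function f = u + i v:
   hat f(k) = (2pi)^{-m} int_{T^m} f(t) e^{-i(k,t)} dt, real and imag. parts *)
Definition fhat_re {m} (u v : pt m -> R) (k : 'I_m -> Z) : R :=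
  / (2 * PI) ^ m * integral_T (fun t => u t * cos (kdot k t) + v t * sin (kdot k t)).
Definition fhat_im {m} (u v : pt m -> R) (k : 'I_m -> Z) : R :=
  / (2 * PI) ^ m * integral_T (fun t => v t * cos (kdot k t) - u t * sin (kdot k t)).
Definition fhat_abs {m} (u v : pt m -> R) (k : 'I_m -> Z) : R :=
  sqrt (fhat_re u v k ^ 2 + fhat_im u v k ^ 2).

Definition cube_sum {m} (p : R) (u v : pt m -> R) (N : nat) : R :=
  \big[Rplus/0]_(c : {ffun 'I_m -> 'I_(2 * N + 1)})
     rpow (fhat_abs u v (fun j => (Z.of_nat (c j) - Z.of_nat N)%Z)) p.

(* ||f||_{A_p(T^m)} = ||hat f||_{l^p(Z^m)} = (sum_k |hat f(k)|^p)^{1/p}, in [0,+oo] *)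
Definition Ap_norm {m} (p : R) (u v : pt m -> R) : Rbar :=
  match Lub_Rbar (fun r => exists N : nat, r = cube_sum p u v N) with
  | Finite s => Finite (rpow s (/ p))
  | p_infty => p_infty
  | m_infty => m_infty
  end.

(* Main.v *)
From HB Require Import structures.
Require Import Defs.
From mathcomp Require Import ssreflect ssrbool ssrfun eqtype ssrnat seq choice fintype finfun bigop.
From mathcomp Require Import zify.
From Stdlib Require Import Reals Znat Lra Lia FunctionalExtensionality ClassicalEpsilon.
From Coquelicot Require Import Coquelicot.

Local Open Scope R_scope.

(* Write s = nu + alpha and f = e^{i lambda phi}, |lambda| >= 1. If |lambda| h <= eta <= 1, the
   (nu+1)-st difference of step h of f along any coordinate is O(eta^s) uniformly: the l-th
   difference of lambda phi is O(eta^min(l,s)), and a discrete Leibniz rule carries these weights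
   over to the exponential. For h of order 1/K such a difference does not decrease |hat f(k)| when
   |k_i| is in [K/2, K], so by Bessel the dyadic shell max|k_i| ~ 2^j |lambda| carries l^2 mass
   O(2^(-2js)). By Hoelder its l^p mass is O(2^(-jsp) (2^j |lambda|)^(m(1-p/2))), and the sum over j
   is a convergent geometric series since s > m(1/p-1/2). Bessel's inequality alone handles
   the frequencies max|k_i| = O(|lambda|). *)

(** Differences can exploit the Hoelder condition of order alpha, which derivatives cannot see, and
    they act on each Fourier coefficient as multiplication by a power of e^{i k_i h} - 1. The
    difficulty is uniformity: no constant may depend on lambda or on the step, which is why
    smallness is measured in powers of eta and not of h. For l >= 1 the exponent mu = min(l,s) is at
    least 1, because s >= 1; with |lambda| >= 1 this gives |lambda| h^mu <= (|lambda| h)^mu <=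
    eta^mu, and lambda disappears from the bounds on the phase. Since min(l,s) saturates, the
    weights are not multiplicative; only gam l * gam k <= gam (l + k) survives, and this is the
    direction that products require. The value of lambda phi itself (order 0) is not small, so the
    bounds on a phase start at order 1, while those on the factors of a product start at order 0. A
    sup bound on the differences controls their mean square, hence, by Bessel, the coefficients. *)

(** * Iterated differences of products and of e^{iz} *)

Definition diff {X : Type} (tau : X -> X) (G : X -> R) : X -> R :=
  fun x => G (tau x) - G x.

Lemma diffsS {X : Type} (tau : X -> X) (l : nat) (G : X -> R) (x : X) :
  iter l.+1 (diff tau) G x = iter l (diff tau) G (tau x) - iter l (diff tau) G x.
Proof. by []. Qed.

Lemma diffs_add {X : Type} (tau : X -> X) (l : nat) (G H : X -> R) (x : X) :
  iter l (diff tau) (fun y => G y + H y) x =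
  iter l (diff tau) G x + iter l (diff tau) H x.
Proof. by elim: l x => [|l IH] x //; rewrite !diffsS !IH; lra. Qed.

Lemma diffs_scal {X : Type} (tau : X -> X) (l : nat) (a : R) (G : X -> R) (x : X) :
  iter l (diff tau) (fun y => a * G y) x = a * iter l (diff tau) G x.
Proof. by elim: l x => [|l IH] x //; rewrite !diffsS !IH; lra. Qed.

Lemma diffs_shift {X : Type} (tau : X -> X) (l : nat) (G : X -> R) (x : X) :
  iter l (diff tau) (fun y => G (tau y)) x = iter l (diff tau) G (tau x).
Proof. by elim: l x => [|l IH] x //; rewrite !diffsS !IH. Qed.

(** The model is gam l = eta^min(l,s) with 0 < eta <= 1; the fields are the properties of these
    weights that the Leibniz rule and the exponential use. *)
Record gauge (gam : nat -> R) : Prop := Gauge {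
  gauge0 : gam O = 1%R;
  gauge_ge0 : forall l, 0 <= gam l;
  gauge_mul : forall l k, gam l * gam k <= gam (l + k)%nat;
  gauge_add : forall l k, gam (l + k)%nat <= gam l }.

(** [d] counts the orders of smallness that [G] already has. The lower end [a] is 1 for functions
    such as lambda phi, whose differences are small but whose values are not. *)
Definition dbounded {X : Type} (tau : X -> X) (gam : nat -> R)
    (a b d : nat) (A : R) (G : X -> R) : Prop :=
  forall l, leq a l -> leq l b -> forall x,
    Rabs (iter l (diff tau) G x) <= A * gam (l + d)%nat.

(* Discrete Leibniz rule: D(GH) = (G o tau) DH + (DG) H. *)
Lemma dbounded_mult {X : Type} (tau : X -> X) (gam : nat -> R) (L d e : nat)
    (A B : R) (G H : X -> R) :
  gauge gam -> 0 <= A -> 0 <= B ->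
  dbounded tau gam 0 L d A G -> dbounded tau gam 0 L e B H ->
  dbounded tau gam 0 L (d + e) (2 ^ L * A * B) (fun x => G x * H x).
Proof.
move=> Hg HA HB HG HH l _ hl x.
have P0 : 0 <= A * B * gam (l + (d + e))%nat.
  by apply: Rmult_le_pos; [apply: Rmult_le_pos | exact: gauge_ge0].
(* Each use of the Leibniz rule doubles the number of products, so the induction carries 2^l, with
   both hypotheses cut down to order l. *)
suff P : Rabs (iter l (diff tau) (fun y => G y * H y) x) <= 2 ^ l * (A * B * gam (l + (d + e))%nat).
  apply: (Rle_trans _ _ _ P).
  rewrite (_ : 2 ^ L * A * B * gam (l + (d + e))%nat = 2 ^ L * (A * B * gam (l + (d + e))%nat)); last by ring.
  apply: Rmult_le_compat_r => //; apply: Rle_pow; [lra | exact/leP].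
clear P0.
have {}HG : dbounded tau gam 0 l d A G by move=> k h1 h2; apply: HG => //; apply: leq_trans hl.
have {}HH : dbounded tau gam 0 l e B H by move=> k h1 h2; apply: HH => //; apply: leq_trans hl.
clear hl L.
elim: l d e G H HG HH x => [|l IH] d e G H HG HH x.
  rewrite /= Rabs_mult Rmult_1_l add0n.
  apply: (Rle_trans _ ((A * gam d) * (B * gam e))).
    apply: Rmult_le_compat; try exact: Rabs_pos.
      exact: (HG 0%nat).
    exact: (HH 0%nat).
  rewrite (_ : A * gam d * (B * gam e) = A * B * (gam d * gam e)); last by ring.
  apply: Rmult_le_compat_l; [exact: Rmult_le_pos | exact: gauge_mul].
rewrite iterSr.
rewrite (_ : diff tau (fun y => G y * H y) =
  fun y => G (tau y) * diff tau H y + diff tau G y * H y); last first.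
  by apply: functional_extensionality => y; rewrite /diff; ring.
rewrite diffs_add; apply: (Rle_trans _ _ _ (Rabs_triang _ _)).
have E1 := IH d e.+1 (fun y => G (tau y)) (diff tau H) _ _ x.
have E2 := IH d.+1 e (diff tau G) H _ _ x.
rewrite (_ : 2 ^ l.+1 * (A * B * gam (l.+1 + (d + e))%nat) =
   2 ^ l * (A * B * gam (l + (d + e.+1))%nat) + 2 ^ l * (A * B * gam (l + (d.+1 + e))%nat)); last first.
  by rewrite !(addnS, addSn) /=; ring.
apply: Rplus_le_compat; [apply: E1 | apply: E2].
- by move=> k _ hk y; rewrite diffs_shift; apply: HG => //; exact: leqW.
- by move=> k _ hk y; rewrite -iterSr addnS -addSn; apply: HH.
- by move=> k _ hk y; rewrite -iterSr addnS -addSn; apply: HG.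
- by move=> k _ hk y; apply: HH => //; exact: leqW.
Qed.

Lemma Rabs_sin_le (z : R) : Rabs (sin z) <= Rabs z.
Proof.
have [c [_ E]] := MVT_gen sin 0 z cos
  (fun x _ => is_derive_sin x) (fun x _ => continuity_sin x).
rewrite sin_0 !Rminus_0_r in E.
rewrite E Rabs_mult -{2}(Rmult_1_l (Rabs z)).
by apply: Rmult_le_compat_r; [exact: Rabs_pos | apply: Rabs_le; exact: COS_bound].
Qed.

Lemma Rabs_cos_sub1_le (z : R) : Rabs (cos z - 1) <= Rabs z.
Proof.
have [c [_ E]] := MVT_gen cos 0 z (fun x => - sin x)
  (fun x _ => is_derive_cos x) (fun x _ => continuity_cos x).
rewrite cos_0 Rminus_0_r in E.
rewrite E Rabs_mult Rabs_Ropp -{2}(Rmult_1_l (Rabs z)).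
by apply: Rmult_le_compat_r; [exact: Rabs_pos | apply: Rabs_le; exact: SIN_bound].
Qed.

(* D e^{iz} = e^{iz} (e^{iDz} - 1), and Dz has one more order of smallness than z. *)
Lemma dbounded_cos_sin (X : Type) (L : nat) (B : R) :
  0 <= B -> exists C, 0 <= C /\
  forall (tau : X -> X) (gam : nat -> R) (d : nat) (z : X -> R), gauge gam ->
    dbounded tau gam 1 L d B z ->
    dbounded tau gam 1 L d C (fun x => cos (z x)) /\
    dbounded tau gam 1 L d C (fun x => sin (z x)).
Proof.
move=> HB; elim: L => [|L [C [HC IH]]].
  exists 0; split; first lra.
  by move=> tau gam d z Hg Hz; split => l h1 h2; have := leq_trans h1 h2.
(* Leibniz constant for a product of a factor of e^{iz}, bounded with 1 + C, and a factor of e^{iDz}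
   - 1, bounded with B + C. The real and the imaginary part are each a sum of two such products,
   hence C' + C' below. *)
set C' := 2 ^ L * (1 + C) * (B + C).
have HC' : 0 <= C'.
  by apply: Rmult_le_pos; [apply: Rmult_le_pos; [apply: pow_le; lra|lra] | lra].
exists (C' + C'); split; first lra.
move=> tau gam d z Hg Hz.
have g0 := gauge_ge0 _ Hg.
have Hz' : dbounded tau gam 1 L d.+1 B (diff tau z).
  by move=> k h1 h2 y; rewrite -iterSr addnS -addSn; apply: Hz.
have Hz0 : dbounded tau gam 1 L d B z.
  by move=> k h1 h2; apply: Hz => //; exact: leqW.
(* The induction hypothesis serves twice, for z at level [d] and for Dz at level [d.+1]; this is why
   its constant precedes the quantifiers over [tau], [gam] and [d]. *)
have [Hc Hs] := IH _ _ _ _ Hg Hz0.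
have [Hc' Hs'] := IH _ _ _ _ Hg Hz'.
(* Order 0 is added through |f| <= 1 = gam 0, at the price of giving up the [d] orders of
   smallness. *)
have low (f : X -> R) : (forall x, Rabs (f x) <= 1) -> dbounded tau gam 1 L d C f ->
    dbounded tau gam 0 L 0 (1 + C) f.
  move=> f1 Hf [_ _ x|l _ hl x].
    rewrite addn0 /= (gauge0 _ Hg); have := f1 x; lra.
  have := Hf l.+1 isT hl x; rewrite addn0.
  have := Rmult_le_compat_l C _ _ HC (gauge_add _ Hg l.+1 d).
  have := g0 l.+1; lra.
(* Here order 0 keeps the smallness, since |f| is dominated by |Dz|, which is at most B * gam (d +
   1). *)
have high (f : X -> R) : (forall x, Rabs (f x) <= Rabs (diff tau z x)) -> 
    dbounded tau gam 1 L d.+1 C f -> dbounded tau gam 0 L d.+1 (B + C) f.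
  move=> f1 Hf [_ _ x|l _ hl x].
    have := Hz 1%nat isT isT x; rewrite /= add0n add1n; have := f1 x.
    have := Rmult_le_pos _ _ HC (g0 d.+1); lra.
  have := Hf l.+1 isT hl x.
  have := Rmult_le_pos _ _ HB (g0 (l.+1 + d.+1)%nat); lra.
have Lc := low (fun x => cos (z x)) (fun x => Rabs_le _ _ (COS_bound _)) Hc.
have Ls := low (fun x => sin (z x)) (fun x => Rabs_le _ _ (SIN_bound _)) Hs.
have Us := high (fun x => sin (diff tau z x)) (fun x => Rabs_sin_le _) Hs'.
have Uc : dbounded tau gam 0 L d.+1 (B + C) (fun x => cos (diff tau z x) - 1).
  apply: high => [x|]; first exact: Rabs_cos_sub1_le.
  (* The constant 1 vanishes under the first difference, so the bound for cos (Dz) carries over. *)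
  case=> [//|l] h1 h2 x.
  have := Hc' l.+1 h1 h2 x; rewrite !iterSr.
  rewrite (_ : diff tau (fun x0 => cos (diff tau z x0) - 1) =
               diff tau (fun x0 => cos (diff tau z x0))) //.
  by apply: functional_extensionality => y; rewrite /diff; ring.
have HB1 : 0 <= 1 + C by lra.
have HB2 : 0 <= B + C by lra.
have P f g Hf Hg' := dbounded_mult tau gam L 0 d.+1 _ _ f g Hg HB1 HB2 Hf Hg'.
have split_z y : z (tau y) = z y + diff tau z y by rewrite /diff; ring.
split; case=> [//|l] _ hl x; rewrite iterSr.
- rewrite (_ : diff tau (fun y => cos (z y)) = fun y => 
     cos (z y) * (cos (diff tau z y) - 1) + (-1) * (sin (z y) * sin (diff tau z y))); last first.
    apply: functional_extensionality => y.
    rewrite {1}/diff split_z cos_plus; ring.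
  rewrite diffs_add diffs_scal; apply: (Rle_trans _ _ _ (Rabs_triang _ _)).
  rewrite Rabs_mult Rabs_Ropp Rabs_R1 Rmult_1_l Rmult_plus_distr_r addSn -addnS.
  apply: Rplus_le_compat; [exact: (P _ _ Lc Uc) | exact: (P _ _ Ls Us)].
- rewrite (_ : diff tau (fun y => sin (z y)) = fun y => 
     sin (z y) * (cos (diff tau z y) - 1) + cos (z y) * sin (diff tau z y)); last first.
    apply: functional_extensionality => y.
    rewrite {1}/diff split_z sin_plus; ring.
  rewrite diffs_add; apply: (Rle_trans _ _ _ (Rabs_triang _ _)).
  rewrite Rmult_plus_distr_r addSn -addnS.
  apply: Rplus_le_compat; [exact: (P _ _ Ls Uc) | exact: (P _ _ Lc Us)].
Qed.

(** * Finite sums and finite maxima of reals *)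

HB.instance Definition _ := Monoid.isComLaw.Build R 0 Rplus
  (fun x y z => esym (Rplus_assoc x y z)) Rplus_comm Rplus_0_l.

Lemma sum_le (I : Type) (s : seq I) (P : pred I) (F G : I -> R) :
  (forall i, P i -> F i <= G i) ->
  \big[Rplus/0]_(i <- s | P i) F i <= \big[Rplus/0]_(i <- s | P i) G i.
Proof.
by move=> H; apply: (big_ind2 Rle) => //; [lra | move=> *; apply: Rplus_le_compat].
Qed.

Lemma sum_ge0 (I : Type) (s : seq I) (P : pred I) (F : I -> R) :
  (forall i, P i -> 0 <= F i) -> 0 <= \big[Rplus/0]_(i <- s | P i) F i.
Proof. by move=> H; apply: (big_ind (Rle 0)) => //; [lra | move=> *; lra]. Qed.

Lemma sum_scal (I : Type) (s : seq I) (P : pred I) (a : R) (F : I -> R) :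
  \big[Rplus/0]_(i <- s | P i) (a * F i) = a * \big[Rplus/0]_(i <- s | P i) F i.
Proof. by apply: (big_ind2 (fun x y => x = a * y)) => [|x1 x2 y1 y2 -> ->|] //; ring. Qed.

Lemma sum_const (I : finType) (P : pred I) (a : R) :
  \big[Rplus/0]_(i | P i) a = INR #|P| * a.
Proof.
rewrite big_const; elim: #|P| => [|n IH]; first by rewrite /= Rmult_0_l.
by rewrite S_INR /= IH; ring.
Qed.

Lemma finite_uniform_bound (T : finType) (Q : T -> R -> Prop) :
  (forall t M M', M <= M' -> Q t M -> Q t M') ->
  (forall t, exists M, Q t M) -> exists M, 0 <= M /\ forall t, Q t M.
Proof.
move=> mono H.
suff [M [M0 HM]] : exists M, 0 <= M /\ forall t, t \in enum T -> Q t M.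
  by exists M; split => // t; apply: HM; rewrite mem_enum.
elim: (enum T) => [|t s [M [M0 IH]]]; first by exists 0; split => //; lra.
have [M' HM'] := H t.
exists (Rmax M M'); split; first by apply: Rle_trans M0 _; exact: Rmax_l.
move=> u; rewrite in_cons => /orP [/eqP ->|hu].
  by apply: mono HM'; exact: Rmax_r.
by apply: mono (IH u hu); exact: Rmax_l.
Qed.

(** * Translations along a coordinate and periodicity *)

Lemma updE {m} (x : pt m) i s : upd x i s i = s.
Proof. by rewrite /upd eqxx. Qed.

Lemma upd_neq {m} (x : pt m) i j s : j != i -> upd x i s j = x j.
Proof. by rewrite /upd => /negbTE ->. Qed.

Lemma upd_id {m} (x : pt m) i : upd x i (x i) = x.
Proof. by apply: functional_extensionality => j; rewrite /upd; case: eqP => [->|]. Qed.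

Lemma upd_upd {m} (x : pt m) i s t : upd (upd x i s) i t = upd x i t.
Proof. by apply: functional_extensionality => j; rewrite /upd; case: eqP. Qed.

Lemma upd_comm {m} (x : pt m) i j s t : i != j ->
  upd (upd x i s) j t = upd (upd x j t) i s.
Proof.
move=> ij; apply: functional_extensionality => k; rewrite /upd.
by case: (eqVneq k j) => [->|//]; rewrite eq_sym (negbTE ij).
Qed.

Definition translate {m} (i : 'I_m) (h : R) (x : pt m) : pt m := upd x i (x i + h).

Lemma translate_upd {m} (i : 'I_m) h (x : pt m) s :
  translate i h (upd x i s) = upd x i (s + h).
Proof. by rewrite /translate updE upd_upd. Qed.

Lemma translate_upd_neq {m} (i j : 'I_m) h (x : pt m) s : i != j ->
  translate i h (upd x j s) = upd (translate i h x) j s.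
Proof. by move=> ij; rewrite /translate upd_neq // upd_comm // eq_sym. Qed.

Lemma periodic_Z {m} (F : pt m -> R) : periodic F -> forall (x : pt m) i (z : Z),
  F (translate i (2 * PI * IZR z) x) = F x.
Proof.
move=> HF x i z.
have P (n : nat) (y : pt m) : F (translate i (2 * PI * INR n) y) = F y.
  elim: n => [|n IH]; first by rewrite /translate /= Rmult_0_r Rplus_0_r upd_id.
  rewrite -IH -(HF (translate i (2 * PI * INR n) y) i) /translate updE upd_upd S_INR.
  by do 2 f_equal; ring.
case: (Z.le_gt_cases 0 z) => hz.
  by rewrite -(Z2Nat.id z hz) -INR_IZR_INZ P.
have E : IZR z = - INR (Z.to_nat (- z)) by rewrite INR_IZR_INZ Z2Nat.id ?opp_IZR; [ring | lia].
rewrite E -(P (Z.to_nat (- z)) (translate i _ x)) /translate updE upd_upd.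
rewrite (_ : x i + _ + _ = x i) ?upd_id //; ring.
Qed.

Lemma periodic_box {m} (F : pt m -> R) (x : pt m) : periodic F ->
  exists y, (forall j, 0 <= y j <= 2 * PI) /\ F y = F x.
Proof.
move=> HF.
suff [y [Hy E]] : exists y, (forall j, j \in enum 'I_m -> 0 <= y j <= 2 * PI) /\ F y = F x.
  by exists y; split => // j; apply: Hy; rewrite mem_enum.
elim: (enum 'I_m) => [|i s [y [Hy E]]]; first by exists x.
have pi0 := PI_RGT_0.
(* [up r] lies strictly above r and at most 1 above it, so [up r - 1] is the floor of r and r + 1 -
   [up r] lies in [0,1). *)
exists (translate i (2 * PI * IZR (1 - up (y i / (2 * PI)))) y); split; last by rewrite periodic_Z.
move=> j; rewrite in_cons /translate; case: (eqVneq j i) => [-> _|ji /= hj]; last first.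
  by rewrite upd_neq //; exact: Hy.
rewrite updE minus_IZR; have [] := archimed (y i / (2 * PI)).
set r := y i / (2 * PI) => h1 h2.
rewrite (_ : y i = 2 * PI * r); last by rewrite /r; field; lra.
nra.
Qed.

(** * Continuous periodic functions are bounded *)

(** [compactness_list] is stated for nested pairs [Tn]; these conversions carry it over to points
    indexed by ['I_m]. *)
Fixpoint tuple_nth (n : nat) : Compactness.Tn n R -> nat -> R :=
  match n with
  | O => fun _ _ => 0
  | S n => fun x k => match k with O => fst x | S k => tuple_nth n (snd x) k end
  end.

Fixpoint tuple_mk (n : nat) (f : nat -> R) : Compactness.Tn n R :=
  match n with
  | O => tt
  | S n => (f O, tuple_mk n (fun k => f (S k)))
  end.

Lemma tuple_nth_mk n f k : leq k.+1 n -> tuple_nth n (tuple_mk n f) k = f k.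
Proof. by elim: n f k => [|n IH] f [|k] //= hk; rewrite IH. Qed.

Lemma bounded_n_mk n (a b : R) f : (forall k, leq k.+1 n -> a <= f k <= b) ->
  bounded_n n (tuple_mk n (fun=> a)) (tuple_mk n (fun=> b)) (tuple_mk n f).
Proof.
elim: n f => [|n IH] f H //=; split; first exact: H.
by apply: IH => k hk; apply: H.
Qed.

Lemma close_n_nth n d x t : close_n n d x t ->
  forall k, leq k.+1 n -> Rabs (tuple_nth n x k - tuple_nth n t k) < d.
Proof.
elim: n x t => [|n IH] // [x1 x2] [t1 t2] /= [H1 H2] [|k] hk //=.
exact: IH.
Qed.

Lemma dist_lt {m} (x y : pt m) (d : R) : 0 < d ->
  (forall j, Rabs (x j - y j) < d / (INR m + 1)) -> Defs.dist x y < d.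
Proof.
move=> d0 H; have m0 := pos_INR m.
(* The sum of squares is at most m e^2, which is strictly below (m + 1)^2 e^2 = d^2; the summand 1
   also covers m = 0. *)
set e := d / (INR m + 1) in H.
have e0 : 0 < e by apply: Rdiv_lt_0_compat; lra.
have Ed : d = e * (INR m + 1) by rewrite /e; field; lra.
have le : \big[Rplus/0]_(j < m) (x j - y j) ^ 2 <= INR m * e ^ 2.
  apply: (Rle_trans _ (INR #|'I_m| * e ^ 2)); last by rewrite card_ord; lra.
  rewrite -sum_const; apply: sum_le => j _.
  rewrite -(pow2_abs (x j - y j)); apply: pow_incr; split; first exact: Rabs_pos.
  exact/Rlt_le/H.
rewrite /Defs.dist -(sqrt_pow2 d); last lra.
apply: sqrt_lt_1_alt; split; first by apply: sum_ge0 => j _; exact: pow2_ge_0.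
have : 0 < e ^ 2 by apply: pow_lt.
rewrite Ed Rpow_mult_distr; nra.
Qed.

Lemma continuous_periodic_bounded {m} (F : pt m -> R) :
  periodic F -> continuous_m F -> exists M, forall x, Rabs (F x) <= M.
Proof.
move=> HP HC.
pose toPt (t : Compactness.Tn m R) : pt m := fun j => tuple_nth m t j.
have H (t : Compactness.Tn m R) : exists d : posreal, forall y : pt m,
    (forall j, Rabs (y j - toPt t j) < d) -> Rabs (F y - F (toPt t)) < 1.
  have [d [d0 Hd]] := HC (toPt t) 1 Rlt_0_1.
  have d1 : 0 < d / (INR m + 1) by apply: Rdiv_lt_0_compat => //; have := pos_INR m; lra.
  by exists (mkposreal _ d1) => y Hy; apply: Hd; apply: dist_lt.
pose delta t := proj1_sig (constructive_indefinite_description _ (H t)).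
have Hdelta t := proj2_sig (constructive_indefinite_description _ (H t)).
(* A finite subcover of the cube [0, 2 pi]^m by neighbourhoods on which [F] varies by less than 1;
   [compactness_list] asserts it under a double negation. *)
have [l Hl] := NNPP _ (compactness_list m (tuple_mk m (fun=> 0)) (tuple_mk m (fun=> 2 * PI)) delta).
have [M HM] : exists M, forall t, List.In t l -> Rabs (F (toPt t)) <= M.
  elim: l {Hl} => [|t l [M HM]]; first by exists 0.
  exists (Rmax M (Rabs (F (toPt t)))) => u /= [<-|hu]; first exact: Rmax_r.
  by apply: Rle_trans (HM u hu) _; exact: Rmax_l.
exists (M + 1) => x.
have [y [Hy <-]] := periodic_box F x HP.
pose f k := if insub k is Some j then y j else 0.
have fE (j : 'I_m) : f j = y j by rewrite /f valK.
have [|t [tl [_ tc]]] := Hl (tuple_mk m f).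
  by apply: bounded_n_mk => k hk; rewrite -[k]/(nat_of_ord (Ordinal hk)) fE.
have : Rabs (F y - F (toPt t)) < 1.
  apply: Hdelta => j.
  by have := close_n_nth _ _ _ _ tc j (ltn_ord j); rewrite tuple_nth_mk // fE.
have := HM t tl; have := Rabs_triang (F y - F (toPt t)) (F (toPt t)).
rewrite (_ : F y - F (toPt t) + F (toPt t) = F y); [lra | ring].
Qed.

(** * Differences of phi along a coordinate *)

Lemma periodic_partial {m} (i : 'I_m) (F : pt m -> R) : periodic F -> periodic (partial i F).
Proof.
move=> HF x j; rewrite /partial; case: (eqVneq i j) => [<-|ij].
  rewrite updE /Derive; congr (real _); apply: Lim_ext => h.
  rewrite !upd_upd; do 2 f_equal.
    rewrite -(HF (upd x i (x i + h)) i) updE upd_upd; do 2 f_equal; ring.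
  by rewrite HF upd_id.
rewrite upd_neq //; apply: Derive_ext => s.
rewrite upd_comm 1?eq_sym // -(HF (upd x i s) j) upd_neq 1?eq_sym //.
Qed.

Lemma periodic_Dseq {m} (ix : seq 'I_m) (F : pt m -> R) : periodic F -> periodic (Dseq ix F).
Proof. by move=> HF; elim: ix => [|i ix IH] //=; apply: periodic_partial. Qed.

Lemma is_derive_diffs {m} (i : 'I_m) (h : R) (F : pt m -> R) (c : nat) (x : pt m) (s : R) :
  ex_partial i F ->
  is_derive (fun t => iter c (diff (translate i h)) F (upd x i t)) s
    (iter c (diff (translate i h)) (partial i F) (upd x i s)).
Proof.
move=> HF; elim: c s => [|c IH] s.
  rewrite /= /partial updE.
  rewrite (Derive_ext (fun t => F (upd (upd x i s) i t)) (fun t => F (upd x i t))); last first.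
    by move=> t; rewrite upd_upd.
  apply: Derive_correct; have := HF (upd x i s); rewrite updE.
  by apply: ex_derive_ext => t; rewrite upd_upd.
rewrite diffsS translate_upd.
apply: (is_derive_ext (fun t => minus (iter c (diff (translate i h)) F (upd x i (t + h)))
    (iter c (diff (translate i h)) F (upd x i t)))).
  by move=> t; rewrite diffsS translate_upd.
apply: is_derive_minus; last exact: IH.
rewrite -[iter c _ (partial i F) (upd x i (s + h))](scal_one (K := R_AbsRing)).
apply: (is_derive_comp (fun t => iter c (diff (translate i h)) F (upd x i t)) (fun t => t + h)); first exact: IH.
by auto_derive.
Qed.

(** The mean value theorem trades the outermost difference for a derivative and a factor h. *)
Lemma diffs_partial_le {m} (i : 'I_m) (h M : R) (F : pt m -> R) (c : nat) :
  0 <= h -> ex_partial i F ->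
  (forall x, Rabs (iter c (diff (translate i h)) (partial i F) x) <= M) ->
  forall x, Rabs (iter c.+1 (diff (translate i h)) F x) <= M * h.
Proof.
move=> h0 HF HM x; rewrite diffsS -{2}(upd_id x i) {1}/translate.
have D := fun s => is_derive_diffs i h F c x s HF.
have [z [_ E]] := MVT_gen (fun t => iter c (diff (translate i h)) F (upd x i t)) (x i) (x i + h) _
  (fun s _ => D s) (fun s _ => proj2 (continuity_pt_filterlim _ s)
                       (ex_derive_continuous _ s (ex_intro _ _ (D s)))).
rewrite E Rabs_mult (_ : x i + h - x i = h); last by ring.
by rewrite (Rabs_pos_eq h) //; apply: Rmult_le_compat_r.
Qed.

Lemma diffs_Dseq_le {m} (i : 'I_m) (h M : R) (F : pt m -> R) (c l : nat) :
  0 <= h -> (forall k, leq k.+1 l -> ex_partial i (Dseq (nseq k i) F)) ->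
  (forall x, Rabs (iter c (diff (translate i h)) (Dseq (nseq l i) F) x) <= M) ->
  forall x, Rabs (iter (l + c) (diff (translate i h)) F x) <= M * h ^ l.
Proof.
move=> h0; elim: l c M => [|l IH] c M HF HM x.
  by rewrite add0n Rmult_1_r.
rewrite addSn -addnS.
rewrite (_ : M * h ^ l.+1 = (M * h) * h ^ l); last by rewrite /=; ring.
apply: IH => [k hk|y]; first by apply: HF; exact: leqW.
by apply: diffs_partial_le => //; apply: HF.
Qed.

Lemma dist_translate {m} (i : 'I_m) (h : R) (x : pt m) : Defs.dist (translate i h x) x = Rabs h.
Proof.
rewrite /Defs.dist (bigD1 i) //= big1 => [|j ji]; last by rewrite /translate upd_neq //; ring.
rewrite /translate updE -(sqrt_Rsqr_abs h); f_equal; rewrite /Rsqr; ring.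
Qed.

(** An order l <= nu is paid for by l derivatives, bounded by compactness. At order nu + 1, nu
    derivatives give h^nu and the remaining difference gives h^alpha by the Hoelder condition. *)
Lemma C_nu_alpha_diffs_le {m} (nu : nat) (alpha : R) (phi : pt m -> R) :
  0 <= alpha <= 1 -> C_nu_alpha m nu alpha phi ->
  exists B, 0 <= B /\ forall (i : 'I_m) (h : R), 0 < h ->
    forall l, leq 1 l -> leq l nu.+1 -> forall x,
    Rabs (iter l (diff (translate i h)) phi x) <=
      B * Rpower h (Rmin (INR l) (INR nu + alpha)).
Proof.
move=> Ha [HP [Hex [HC HL]]].
have [M [M0 HM]] := finite_uniform_bound _
  (fun (t : 'I_m * 'I_nu.+1) M => forall x, Rabs (Dseq (nseq t.2 t.1) phi x) <= M)
  (fun t M M' h H x => Rle_trans _ _ _ (H x) h)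
  (fun t => continuous_periodic_bounded _ (periodic_Dseq _ _ HP)
     (HC _ (etrans (f_equal (leq^~ nu) (size_nseq t.2 t.1)) (ltn_ord t.2)))).
have {}HM (i : 'I_m) l (hl : leq l.+1 nu.+1) := HM (i, Ordinal hl).
simpl in HM.
have [K [K0 HK]] : exists K, 0 <= K /\ forall (i : 'I_m) h, 0 < h -> forall x,
    Rabs (iter 1 (diff (translate i h)) (Dseq (nseq nu i) phi) x) <= K * Rpower h alpha.
  case: (Rle_lt_or_eq_dec 0 alpha (proj1 Ha)) => [a0|<-].
    have [K HK] := HL a0; exists (Rabs K); split; first exact: Rabs_pos.
    move=> i h h0 x; apply: (Rle_trans _ _ _ (HK _ (size_nseq _ _) _ _)).
    rewrite dist_translate Rabs_pos_eq; last lra.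
    rewrite /rpow; case: Rle_dec => [|_]; first lra.
    by apply: Rmult_le_compat_r; [rewrite /Rpower; exact/Rlt_le/exp_pos | exact: Rle_abs].
  (* For alpha = 0 no decay is asked for: the difference of two values bounded by M is enough. *)
  exists (2 * M); split; first lra.
  move=> i h h0 x; rewrite Rpower_O // Rmult_1_r.
  have := HM i nu (leqnn _) x; have := HM i nu (leqnn _) (translate i h x).
  rewrite /= /diff => h1 h2; apply: (Rle_trans _ _ _ (Rabs_triang _ _)).
  rewrite Rabs_Ropp; lra.
exists (M + K); split; first lra.
move=> i h h0 l l1 l2 x.
have hp r : 0 < Rpower h r by exact: exp_pos.
have Hex' k : leq k.+1 nu -> ex_partial i (Dseq (nseq k i) phi).
  by move=> hk; apply: Hex; rewrite size_nseq.
move: l2; rewrite leq_eqVlt => /orP [/eqP ->|l2].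
  rewrite Rmin_right; last by rewrite S_INR; lra.
  rewrite Rpower_plus Rpower_pow // -addn1.
  apply: (Rle_trans _ (K * Rpower h alpha * h ^ nu)).
    by apply: diffs_Dseq_le => //; [lra | exact: HK].
  have := hp alpha; have : 0 < h ^ nu by exact: pow_lt.
  move=> p1 p2; have := Rmult_le_pos _ _ M0 (Rlt_le _ _ (Rmult_lt_0_compat _ _ p1 p2)); lra.
rewrite Rmin_left; last by have := le_INR _ _ (elimT leP (l2 : leq l nu)); lra.
rewrite Rpower_pow // -{1}(addn0 l).
apply: (Rle_trans _ (M * h ^ l)).
  apply: diffs_Dseq_le => //; [lra | by move=> k hk; apply: Hex'; apply: leq_trans hk _ |].
  by apply: HM.
by apply: Rmult_le_compat_r; [exact/Rlt_le/pow_lt | lra].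
Qed.

(** * The class of functions to be integrated *)

Definition coord_lipschitz {m} (K : R) (F : pt m -> R) : Prop :=
  forall x i a b, Rabs (F (upd x i a) - F (upd x i b)) <= K * Rabs (a - b).

(* Closed under products and partial integration, so that every function to be
   integrated is continuous along each coordinate. *)
Definition bounded_lipschitz {m} (F : pt m -> R) : Prop :=
  exists B K, [/\ 0 <= B, 0 <= K, (forall x, Rabs (F x) <= B) & coord_lipschitz K F].

Lemma bounded_lipschitz_const {m} (c : R) : @bounded_lipschitz m (fun=> c).
Proof.
exists (Rabs c), 0; split => [||x|x i a b]; [exact: Rabs_pos | lra | exact: Rle_refl |].
rewrite Rmult_0_l Rminus_diag Rabs_R0; lra.
Qed.

Lemma bounded_lipschitz_add {m} (F G : pt m -> R) :
  bounded_lipschitz F -> bounded_lipschitz G -> bounded_lipschitz (fun x => F x + G x).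
Proof.
move=> [B [K [B0 K0 HB HK]]] [B' [K' [B0' K0' HB' HK']]].
exists (B + B'), (K + K'); split => [||x|x i a b]; try lra.
  by apply: Rle_trans (Rabs_triang _ _) _; apply: Rplus_le_compat.
rewrite (_ : F _ + G _ - _ = (F (upd x i a) - F (upd x i b)) + (G (upd x i a) - G (upd x i b))); last by ring.
apply: Rle_trans (Rabs_triang _ _) _; rewrite Rmult_plus_distr_r.
by apply: Rplus_le_compat.
Qed.

Lemma bounded_lipschitz_mult {m} (F G : pt m -> R) :
  bounded_lipschitz F -> bounded_lipschitz G -> bounded_lipschitz (fun x => F x * G x).
Proof.
move=> [B [K [B0 K0 HB HK]]] [B' [K' [B0' K0' HB' HK']]].
exists (B * B'), (B * K' + B' * K); split => [||x|x i a b].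
- exact: Rmult_le_pos.
- by apply: Rplus_le_le_0_compat; apply: Rmult_le_pos.
- by rewrite Rabs_mult; apply: Rmult_le_compat => //; exact: Rabs_pos.
rewrite (_ : F _ * G _ - _ = F (upd x i a) * (G (upd x i a) - G (upd x i b)) + G (upd x i b) * (F (upd x i a) - F (upd x i b))); last by ring.
apply: Rle_trans (Rabs_triang _ _) _; rewrite !Rabs_mult Rmult_plus_distr_r !Rmult_assoc.
by apply: Rplus_le_compat; apply: Rmult_le_compat => //; exact: Rabs_pos.
Qed.

Lemma bounded_lipschitz_scal {m} (c : R) (F : pt m -> R) :
  bounded_lipschitz F -> bounded_lipschitz (fun x => c * F x).
Proof. by move=> HF; apply: bounded_lipschitz_mult HF; exact: bounded_lipschitz_const. Qed.

Lemma bounded_lipschitz_sub {m} (F G : pt m -> R) :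
  bounded_lipschitz F -> bounded_lipschitz G -> bounded_lipschitz (fun x => F x - G x).
Proof.
move=> HF HG; rewrite (_ : (fun _ => _) = fun x => F x + (-1) * G x).
  by apply: bounded_lipschitz_add => //; exact: bounded_lipschitz_scal.
by apply: functional_extensionality => x; ring.
Qed.

Lemma bounded_lipschitz_pow2 {m} (F : pt m -> R) :
  bounded_lipschitz F -> bounded_lipschitz (fun x => F x ^ 2).
Proof.
move=> HF; rewrite (_ : (fun _ => _) = fun x => F x * F x).
  exact: bounded_lipschitz_mult.
by apply: functional_extensionality => x; ring.
Qed.

Lemma bounded_lipschitz_cos {m} (K : R) (G : pt m -> R) : 0 <= K ->
  coord_lipschitz K G -> bounded_lipschitz (fun x => cos (G x)).
Proof.
move=> K0 HG; exists 1, K; split => // [|x|x i a b]; first lra.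
  by apply: Rabs_le; exact: COS_bound.
apply: Rle_trans (HG x i a b); rewrite -Rabs_Ropp -[X in _ <= X]Rabs_Ropp !Ropp_minus_distr.
have [c [_ ->]] := MVT_gen cos (G (upd x i a)) (G (upd x i b)) (fun x => - sin x)
  (fun x _ => is_derive_cos x) (fun x _ => continuity_cos x).
rewrite Rabs_mult -[X in _ <= X]Rmult_1_l; apply: Rmult_le_compat_r; first exact: Rabs_pos.
by rewrite Rabs_Ropp; apply: Rabs_le; exact: SIN_bound.
Qed.

Lemma bounded_lipschitz_sin {m} (K : R) (G : pt m -> R) : 0 <= K ->
  coord_lipschitz K G -> bounded_lipschitz (fun x => sin (G x)).
Proof.
move=> K0 HG; rewrite (_ : (fun _ => _) = fun x => cos (PI / 2 + (-1) * G x)).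
  apply: (bounded_lipschitz_cos K) => // x i a b.
  rewrite (_ : _ - _ = G (upd x i b) - G (upd x i a)); last by ring.
  by rewrite Rabs_minus_sym.
by apply: functional_extensionality => x; rewrite -cos_shift; f_equal; ring.
Qed.

Lemma bounded_lipschitz_translate {m} (j : 'I_m) (h : R) (F : pt m -> R) :
  bounded_lipschitz F -> bounded_lipschitz (fun x => F (translate j h x)).
Proof.
move=> [B [K [B0 K0 HB HK]]]; exists B, K; split => // x i a b.
case: (eqVneq j i) => [->|ji]; last by rewrite !translate_upd_neq.
rewrite !translate_upd (_ : a - b = a + h - (b + h)); [exact: HK | ring].
Qed.

Lemma bounded_lipschitz_diffs {m} (j : 'I_m) (h : R) (F : pt m -> R) (l : nat) :
  bounded_lipschitz F -> bounded_lipschitz (iter l (diff (translate j h)) F).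
Proof.
move=> HF; elim: l => [//|l IH] /=; apply: bounded_lipschitz_sub => //.
exact: bounded_lipschitz_translate.
Qed.

Lemma bounded_lipschitz_ex_RInt {m} (F : pt m -> R) (x : pt m) i a b :
  bounded_lipschitz F -> ex_RInt (fun s => F (upd x i s)) a b.
Proof.
move=> [B [K [_ K0 _ HK]]]; apply: ex_RInt_continuous => z _.
apply/continuity_pt_filterlim => eps e0.
exists (eps / (K + 1)); split; first by apply: Rdiv_lt_0_compat; lra.
move=> y [_ /= Hy]; rewrite /R_dist in Hy *.
apply: Rle_lt_trans (HK x i y z) _.
have : (K + 1) * Rabs (y - z) < eps.
  rewrite (_ : eps = (K + 1) * (eps / (K + 1))); last by field; lra.
  by apply: Rmult_lt_compat_l => //; lra.
have := Rabs_pos (y - z); lra.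
Qed.

(** * Iterated integrals: linearity, monotonicity, translation invariance *)

Definition pint {m} (i : 'I_m) (F : pt m -> R) : pt m -> R :=
  fun x => RInt (fun s => F (upd x i s)) 0 (2 * PI).

Lemma iint_cons {m} (i : 'I_m) ix (F : pt m -> R) : iint (i :: ix) F = pint i (iint ix F).
Proof. by []. Qed.

Lemma two_pi_gt0 : 0 < 2 * PI.
Proof. by have := PI_RGT_0; lra. Qed.

Lemma pint_lin {m} (i : 'I_m) (a b : R) (F G : pt m -> R) :
  bounded_lipschitz F -> bounded_lipschitz G ->
  pint i (fun x => a * F x + b * G x) = fun x => a * pint i F x + b * pint i G x.
Proof.
move=> HF HG; apply: functional_extensionality => x; rewrite /pint.
have EF := bounded_lipschitz_ex_RInt F x i 0 (2 * PI) HF.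
have EG := bounded_lipschitz_ex_RInt G x i 0 (2 * PI) HG.
rewrite -[a * RInt _ _ _](RInt_scal _ _ _ a EF) -[b * RInt _ _ _](RInt_scal _ _ _ b EG).
exact: (RInt_plus _ _ _ _ (ex_RInt_scal _ _ _ a EF) (ex_RInt_scal _ _ _ b EG)).
Qed.

Lemma pint_sub {m} (i : 'I_m) (F : pt m -> R) x y :
  bounded_lipschitz F ->
  pint i F x - pint i F y = RInt (fun s => F (upd x i s) - F (upd y i s)) 0 (2 * PI).
Proof.
move=> HF; symmetry.
by apply: (RInt_minus (V := R_CompleteNormedModule)); apply: bounded_lipschitz_ex_RInt.
Qed.

Lemma bounded_lipschitz_pint {m} (i : 'I_m) (F : pt m -> R) :
  bounded_lipschitz F -> bounded_lipschitz (pint i F).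
Proof.
move=> HF; have pi0 := two_pi_gt0.
have := HF => -[B [K [B0 K0 HB HK]]].
exists (2 * PI * B), (2 * PI * K); split => [||x|x j a b]; try (apply: Rmult_le_pos; lra).
  rewrite (_ : 2 * PI * B = (2 * PI - 0) * B); last by ring.
  apply: abs_RInt_le_const => //; first lra.
  exact: bounded_lipschitz_ex_RInt.
(* Integrating over a coordinate removes the dependence on it; along another coordinate the
   Lipschitz bound is integrated. *)
case: (eqVneq i j) => [->|ij].
  rewrite /pint.
  rewrite (RInt_ext (fun s => F (upd (upd x j b) j s)) (fun s => F (upd (upd x j a) j s))); last first.
    by move=> s _; rewrite !upd_upd.
  rewrite Rminus_diag Rabs_R0; apply: Rmult_le_pos; last exact: Rabs_pos.
  by apply: Rmult_le_pos; lra.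
rewrite pint_sub // (_ : 2 * PI * K * _ = (2 * PI - 0) * (K * Rabs (a - b))); last by ring.
apply: abs_RInt_le_const; first lra.
  by apply: (ex_RInt_minus (V := R_CompleteNormedModule)); apply: bounded_lipschitz_ex_RInt.
by move=> s _; rewrite !(upd_comm _ j i) 1?eq_sym //; exact: HK.
Qed.

Lemma bounded_lipschitz_iint {m} (ix : seq 'I_m) (F : pt m -> R) :
  bounded_lipschitz F -> bounded_lipschitz (iint ix F).
Proof. by move=> HF; elim: ix => [//|i ix IH]; exact: bounded_lipschitz_pint. Qed.

Lemma iint_lin {m} (ix : seq 'I_m) (a b : R) (F G : pt m -> R) :
  bounded_lipschitz F -> bounded_lipschitz G ->
  iint ix (fun x => a * F x + b * G x) = fun x => a * iint ix F x + b * iint ix G x.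
Proof.
move=> HF HG; elim: ix => [//|i ix IH]; rewrite !iint_cons IH pint_lin //;
  exact: bounded_lipschitz_iint.
Qed.

Lemma iint_le {m} (ix : seq 'I_m) (F G : pt m -> R) :
  bounded_lipschitz F -> bounded_lipschitz G -> (forall x, F x <= G x) ->
  forall x, iint ix F x <= iint ix G x.
Proof.
move=> HF HG H; elim: ix => [//|i ix IH] x; rewrite !iint_cons /pint.
apply: RInt_le => [|||s _]; last exact: IH.
- by have := two_pi_gt0; lra.
- exact/bounded_lipschitz_ex_RInt/bounded_lipschitz_iint.
- exact/bounded_lipschitz_ex_RInt/bounded_lipschitz_iint.
Qed.

Lemma iint_const {m} (ix : seq 'I_m) (c : R) :
  iint ix (fun=> c) = fun=> (2 * PI) ^ size ix * c.
Proof.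
elim: ix => [|i ix IH]; first by apply: functional_extensionality => x /=; ring.
rewrite iint_cons IH; apply: functional_extensionality => x.
rewrite /pint RInt_const /scal /= /mult /=; ring.
Qed.

Lemma iint_translate_notin {m} (ix : seq 'I_m) (i : 'I_m) (h : R) (F : pt m -> R) x :
  i \notin ix -> iint ix (fun y => F (translate i h y)) x = iint ix F (translate i h x).
Proof.
elim: ix x => [//|j ix IH] x; rewrite in_cons negb_or => /andP [ij hi].
rewrite !iint_cons /pint; apply: RInt_ext => s _.
by rewrite IH // translate_upd_neq.
Qed.

(** The integrals over [0,h] and [T,T+h] agree by periodicity, and the Chasles relation for [0,T+h]
    does the rest. *)
Lemma RInt_periodic_shift (g : R -> R) (T h : R) :
  (forall s, g (s + T) = g s) -> (forall a b, ex_RInt g a b) ->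
  RInt (fun s => g (s + h)) 0 T = RInt g 0 T.
Proof.
move=> HT Hg.
have sh a b c : RInt (fun s => g (s + c)) a b = RInt g (a + c) (b + c).
  have := RInt_comp_lin g 1 c a b (Hg _ _); rewrite !Rmult_1_l => <-.
  by apply: RInt_ext => s _; rewrite /scal /= /mult /= !Rmult_1_l.
have E : RInt g T (T + h) = RInt g 0 h.
  have := sh 0 h T; rewrite Rplus_0_l (Rplus_comm h) => <-.
  by apply: RInt_ext => s _.
rewrite sh Rplus_0_l.
have C1 := RInt_Chasles g 0 h (T + h) (Hg _ _) (Hg _ _).
have C2 := RInt_Chasles g 0 T (T + h) (Hg _ _) (Hg _ _).
rewrite /plus /= in C1 C2; lra.
Qed.

(** The translation passes through the integrals nested inside the one over coordinate i, whose
    variables are different, and is absorbed there by the one-dimensional shift. *)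
Lemma iint_translate {m} (ix : seq 'I_m) (i : 'I_m) (h : R) (F : pt m -> R) x :
  bounded_lipschitz F -> periodic F -> uniq ix -> i \in ix ->
  iint ix (fun y => F (translate i h y)) x = iint ix F x.
Proof.
move=> HF HP; elim: ix x => [//|j ix IH] x /=.
move=> /andP [jn un]; rewrite in_cons; case: (eqVneq i j) => [ij _|ij /= hi]; last first.
  by apply: RInt_ext => s _; rewrite IH.
subst j; rewrite (RInt_ext _ (fun s => iint ix F (upd x i (s + h)))); last first.
  by move=> s _; rewrite iint_translate_notin // translate_upd.
apply: (RInt_periodic_shift (fun s => iint ix F (upd x i s))) => [s|a b]; last first.
  exact/bounded_lipschitz_ex_RInt/bounded_lipschitz_iint.
(* Periodicity of the inner integral in its parameter: the shift by 2 pi is moved back onto [F]. *)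
rewrite -translate_upd -iint_translate_notin //.
by congr (iint ix _ _); apply: functional_extensionality => y; exact: HP.
Qed.

Lemma integral_lin {m} (a b : R) (F G : pt m -> R) :
  bounded_lipschitz F -> bounded_lipschitz G ->
  integral_T (fun x => a * F x + b * G x) = a * integral_T F + b * integral_T G.
Proof. by move=> HF HG; rewrite /integral_T iint_lin. Qed.

Lemma integral_lin3 {m} (a b c : R) (F G H : pt m -> R) :
  bounded_lipschitz F -> bounded_lipschitz G -> bounded_lipschitz H ->
  integral_T (fun x => a * F x + b * G x + c * H x) =
  a * integral_T F + b * integral_T G + c * integral_T H.
Proof.
move=> HF HG HH.
rewrite (_ : (fun _ => _) = fun x => 1 * (a * F x + b * G x) + c * H x); last first.
  by apply: functional_extensionality => x; ring.
rewrite integral_lin // ?integral_lin //; first ring.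
by apply: bounded_lipschitz_add; apply: bounded_lipschitz_scal.
Qed.

Lemma integral_const {m} (c : R) : @integral_T m (fun=> c) = (2 * PI) ^ m * c.
Proof. by rewrite /integral_T iint_const size_enum_ord. Qed.

Lemma integral_le {m} (F G : pt m -> R) :
  bounded_lipschitz F -> bounded_lipschitz G -> (forall x, F x <= G x) ->
  integral_T F <= integral_T G.
Proof. by move=> HF HG H; exact: iint_le. Qed.

Lemma integral_translate {m} (i : 'I_m) (h : R) (F : pt m -> R) :
  bounded_lipschitz F -> periodic F ->
  integral_T (fun x => F (translate i h x)) = integral_T F.
Proof. by move=> HF HP; apply: iint_translate; rewrite ?enum_uniq ?mem_enum. Qed.

(** * Characters and their orthogonality *)

Lemma kdot_upd {m} (k : 'I_m -> Z) (x : pt m) i a b :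
  kdot k (upd x i a) - kdot k (upd x i b) = IZR (k i) * (a - b).
Proof.
rewrite /kdot (bigD1 i) //= [X in _ - X](bigD1 i) //= !updE.
rewrite (eq_bigr (fun j => IZR (k j) * upd x i b j)) => [|j ji]; last by rewrite !upd_neq.
ring.
Qed.

Lemma kdot_translate {m} (k : 'I_m -> Z) (x : pt m) i h :
  kdot k (translate i h x) = kdot k x + IZR (k i) * h.
Proof.
have := kdot_upd k x i (x i + h) (x i); rewrite upd_id /translate.
rewrite (_ : x i + h - x i = h); [lra | ring].
Qed.

Lemma kdot_coord_lipschitz {m} (k : 'I_m -> Z) :
  exists K, 0 <= K /\ coord_lipschitz K (kdot k).
Proof.
have [K [K0 HK]] := finite_uniform_bound _ (fun j M => Rabs (IZR (k j)) <= M)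
  (fun t M M' h H => Rle_trans _ _ _ H h) (fun t => ex_intro _ _ (Rle_refl _)).
exists K; split => // x i a b; rewrite kdot_upd Rabs_mult.
by apply: Rmult_le_compat_r; [exact: Rabs_pos | exact: HK].
Qed.

Lemma bounded_lipschitz_cos_kdot {m} (k : 'I_m -> Z) : bounded_lipschitz (fun x => cos (kdot k x)).
Proof. by have [K [K0 H]] := kdot_coord_lipschitz k; exact: bounded_lipschitz_cos H. Qed.

Lemma bounded_lipschitz_sin_kdot {m} (k : 'I_m -> Z) : bounded_lipschitz (fun x => sin (kdot k x)).
Proof. by have [K [K0 H]] := kdot_coord_lipschitz k; exact: bounded_lipschitz_sin H. Qed.

Lemma cos_sin_period_Z (x : R) (z : Z) :
  cos (x + 2 * PI * IZR z) = cos x /\ sin (x + 2 * PI * IZR z) = sin x.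
Proof.
have P n y : cos (y + 2 * PI * INR n) = cos y /\ sin (y + 2 * PI * INR n) = sin y.
  rewrite (_ : 2 * PI * INR n = 2 * INR n * PI); last by ring.
  by rewrite cos_period sin_period.
case: (Z.le_gt_cases 0 z) => hz.
  by rewrite -(Z2Nat.id z hz) -INR_IZR_INZ; exact: P.
have E : IZR z = - INR (Z.to_nat (- z)) by rewrite INR_IZR_INZ Z2Nat.id ?opp_IZR; [ring | lia].
have [<- <-] := P (Z.to_nat (- z)) (x + 2 * PI * IZR z).
rewrite E (_ : x + _ + _ = x) //; ring.
Qed.

Lemma kdot_period {m} (k : 'I_m -> Z) (x : pt m) i :
  kdot k (upd x i (x i + 2 * PI)) = kdot k x + 2 * PI * IZR (k i).
Proof. by have := kdot_translate k x i (2 * PI); rewrite /translate => ->; ring. Qed.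

Lemma periodic_cos_kdot {m} (k : 'I_m -> Z) : periodic (fun x => cos (kdot k x)).
Proof. by move=> x i; rewrite kdot_period; case: (cos_sin_period_Z (kdot k x) (k i)). Qed.

Lemma periodic_sin_kdot {m} (k : 'I_m -> Z) : periodic (fun x => sin (kdot k x)).
Proof. by move=> x i; rewrite kdot_period; case: (cos_sin_period_Z (kdot k x) (k i)). Qed.

(* Translating by pi / k_i in the i-th coordinate changes the sign of the integrand. *)
Lemma integral_cos_sin_kdot {m} (k : 'I_m -> Z) (i : 'I_m) : k i <> 0%Z ->
  integral_T (fun x => cos (kdot k x)) = 0 /\ integral_T (fun x => sin (kdot k x)) = 0.
Proof.
move=> ki; have k0 : IZR (k i) <> 0 by apply: not_0_IZR.
have odd (F : pt m -> R) : bounded_lipschitz F -> periodic F ->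
    (forall x, F (translate i (PI / IZR (k i)) x) = - F x) -> integral_T F = 0.
  move=> HF HP E; have := integral_translate i (PI / IZR (k i)) F HF HP.
  rewrite (_ : (fun x => _) = fun x => (-1) * F x + 0 * F x); last first.
    by apply: functional_extensionality => x; rewrite E; ring.
  rewrite integral_lin //; lra.
split; apply: odd => [||x].
- exact: bounded_lipschitz_cos_kdot.
- exact: periodic_cos_kdot.
- rewrite kdot_translate (_ : IZR (k i) * _ = PI) ?neg_cos //; field => //.
- exact: bounded_lipschitz_sin_kdot.
- exact: periodic_sin_kdot.
- rewrite kdot_translate (_ : IZR (k i) * _ = PI) ?neg_sin //; field => //.
Qed.

(** * Bessel's inequality and Fourier coefficients of differences *)

Definition wave_re {m} (u v : pt m -> R) (k : 'I_m -> Z) : pt m -> R :=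
  fun t => u t * cos (kdot k t) + v t * sin (kdot k t).
Definition wave_im {m} (u v : pt m -> R) (k : 'I_m -> Z) : pt m -> R :=
  fun t => v t * cos (kdot k t) - u t * sin (kdot k t).

Lemma bounded_lipschitz_wave {m} (u v : pt m -> R) k :
  bounded_lipschitz u -> bounded_lipschitz v ->
  bounded_lipschitz (wave_re u v k) /\ bounded_lipschitz (wave_im u v k).
Proof.
move=> Hu Hv.
have Hc := bounded_lipschitz_cos_kdot k; have Hs := bounded_lipschitz_sin_kdot k.
by split; [apply: bounded_lipschitz_add | apply: bounded_lipschitz_sub];
  apply: bounded_lipschitz_mult.
Qed.

Lemma periodic_wave {m} (u v : pt m -> R) k :
  periodic u -> periodic v -> periodic (wave_re u v k) /\ periodic (wave_im u v k).
Proof.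
move=> Hu Hv.
by split=> x i; rewrite /wave_re /wave_im Hu Hv (periodic_cos_kdot k x i) (periodic_sin_kdot k x i).
Qed.

Lemma integral_wave {m} (u v : pt m -> R) k :
  integral_T (wave_re u v k) = (2 * PI) ^ m * fhat_re u v k /\
  integral_T (wave_im u v k) = (2 * PI) ^ m * fhat_im u v k.
Proof.
have E : (2 * PI) ^ m <> 0 by apply: pow_nonzero; have := two_pi_gt0; lra.
by split; rewrite /fhat_re /fhat_im -Rmult_assoc Rinv_r // Rmult_1_l.
Qed.

Definition fhat_sq {m} (u v : pt m -> R) (k : 'I_m -> Z) : R :=
  fhat_re u v k ^ 2 + fhat_im u v k ^ 2.

(* Induction on the set of frequencies, subtracting one term of the Fourier series at a time. *)
Lemma bessel {m} (I : eqType) (s : seq I) (k : I -> 'I_m -> Z) (u v : pt m -> R) :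
  uniq s -> (forall c d, c \in s -> d \in s -> c != d -> exists i, k c i <> k d i) ->
  bounded_lipschitz u -> bounded_lipschitz v ->
  (2 * PI) ^ m * (\big[Rplus/0]_(c <- s) fhat_sq u v (k c)) <=
  integral_T (fun x => u x ^ 2 + v x ^ 2).
Proof.
have p0 := two_pi_gt0.
have E0 : 0 < (2 * PI) ^ m by apply: pow_lt.
have norm_bl (f g : pt m -> R) : bounded_lipschitz f -> bounded_lipschitz g ->
    bounded_lipschitz (fun x => f x ^ 2 + g x ^ 2).
  by move=> Hf Hg; apply: bounded_lipschitz_add; exact: bounded_lipschitz_pow2.
elim: s u v => [|c s IH] u v.
  move=> _ _ Hu Hv; rewrite big_nil Rmult_0_r.
  rewrite -[X in X <= _](Rmult_0_r ((2 * PI) ^ m)) -integral_const.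
  apply: integral_le => [||x]; [exact: bounded_lipschitz_const | exact: norm_bl |].
  by have := pow2_ge_0 (u x); have := pow2_ge_0 (v x); lra.
rewrite cons_uniq => /andP [cs us] sep Hu Hv; rewrite big_cons.
have Hc := bounded_lipschitz_cos_kdot (k c); have Hs := bounded_lipschitz_sin_kdot (k c).
set A := fhat_re u v (k c); set B := fhat_im u v (k c).
(* u' + i v' is f - (A + iB) e^{i(k_c,x)} with f = u + iv, that is, f without its Fourier term at
   [k c]. *)
pose u' x := u x - (A * cos (kdot (k c) x) - B * sin (kdot (k c) x)).
pose v' x := v x - (A * sin (kdot (k c) x) + B * cos (kdot (k c) x)).
have Hu' : bounded_lipschitz u'.
  apply: bounded_lipschitz_sub => //; apply: bounded_lipschitz_sub; exact: bounded_lipschitz_scal.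
have Hv' : bounded_lipschitz v'.
  apply: bounded_lipschitz_sub => //; apply: bounded_lipschitz_add; exact: bounded_lipschitz_scal.
have [Wr Wi] := bounded_lipschitz_wave _ _ (k c) Hu Hv.
have [Ir Ii] := integral_wave u v (k c).
have Enorm : integral_T (fun x => u' x ^ 2 + v' x ^ 2) =
    integral_T (fun x => u x ^ 2 + v x ^ 2) - (2 * PI) ^ m * fhat_sq u v (k c).
  (* Pointwise expansion of |f - (A + iB) e^{i(k_c,x)}|^2. The cross terms integrate to -2 (2 pi)^m
     (A^2 + B^2) and the last one to (2 pi)^m (A^2 + B^2), so the mass drops by exactly one Bessel
     term. *)
  rewrite (_ : (fun x => u' x ^ 2 + v' x ^ 2) = fun x =>
     1 * ((1 * (u x ^ 2 + v x ^ 2) + (-2 * A) * wave_re u v (k c) x + (-2 * B) * wave_im u v (k c) x))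
     + (A ^ 2 + B ^ 2) * 1); last first.
    apply: functional_extensionality => x; rewrite /u' /v' /wave_re /wave_im.
    have := sin2_cos2 (kdot (k c) x); rewrite /Rsqr.
    set C := cos _; set S := sin _ => CS.
    have -> : (A ^ 2 + B ^ 2) * 1 = (A ^ 2 + B ^ 2) * (S * S + C * C) by rewrite CS.
    ring.
  have Hn := norm_bl _ _ Hu Hv.
  rewrite integral_lin ?integral_lin3 ?integral_const ?Ir ?Ii //.
  - by rewrite /fhat_sq -/A -/B; ring.
  - by apply: bounded_lipschitz_add; [apply: bounded_lipschitz_add|]; exact: bounded_lipschitz_scal.
  - exact: bounded_lipschitz_const.
have Ehat d : d \in s -> fhat_sq u' v' (k d) = fhat_sq u v (k d).
  move=> ds; have cd : c != d by apply: contraNneq cs => ->.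
  have [i Hi] := sep c d (mem_head _ _) (mem_behead (s := c :: s) ds) cd.
  (* The coefficient at [k d] changes by a multiple of the integral of e^{i(k_c - k_d,x)}, which
     vanishes because the frequencies differ in coordinate i. *)
  pose n j := (k c j - k d j)%Z.
  have En x : kdot n x = kdot (k c) x - kdot (k d) x.
    rewrite /kdot (eq_bigr (fun j => IZR (k c j) * x j + (-1) * (IZR (k d j) * x j))).
      by rewrite big_split /= sum_scal; ring.
    by move=> j _; rewrite /n minus_IZR; ring.
  have [Nc Ns] := integral_cos_sin_kdot n i (fun e => Hi (proj1 (Z.sub_move_0_r _ _) e)).
  have [Wr' Wi'] := bounded_lipschitz_wave _ _ (k d) Hu Hv.
  have Bc := bounded_lipschitz_cos_kdot n; have Bs := bounded_lipschitz_sin_kdot n.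
  rewrite /fhat_sq; congr (_ ^ 2 + _ ^ 2).
    rewrite /fhat_re -/(wave_re u v (k d)); congr (_ * _).
    rewrite (_ : (fun t => _) = fun x =>
      1 * wave_re u v (k d) x + (- A) * cos (kdot n x) + B * sin (kdot n x)); last first.
      apply: functional_extensionality => x.
      rewrite En cos_minus sin_minus /u' /v' /wave_re; ring.
    by rewrite integral_lin3 // Nc Ns; ring.
  rewrite /fhat_im -/(wave_im u v (k d)); congr (_ * _).
  rewrite (_ : (fun t => _) = fun x =>
    1 * wave_im u v (k d) x + (- A) * sin (kdot n x) + (- B) * cos (kdot n x)); last first.
    apply: functional_extensionality => x.
    rewrite En cos_minus sin_minus /u' /v' /wave_im; ring.
  by rewrite integral_lin3 // Nc Ns; ring.
have sep' e d : e \in s -> d \in s -> e != d -> exists i, k e i <> k d i.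
  by move=> es ds; apply: sep; rewrite in_cons ?es ?ds orbT.
have := IH u' v' us sep' Hu' Hv'.
rewrite Enorm (eq_big_seq _ Ehat) Rmult_plus_distr_l.
lra.
Qed.

(* The Fourier coefficient at k of the difference is e^{i k_i h} - 1 times the original one. *)
Lemma fhat_sq_diff {m} (i : 'I_m) (h : R) (u v : pt m -> R) k :
  bounded_lipschitz u -> bounded_lipschitz v -> periodic u -> periodic v ->
  fhat_sq (diff (translate i h) u) (diff (translate i h) v) k =
  (2 - 2 * cos (IZR (k i) * h)) * fhat_sq u v k.
Proof.
move=> Hu Hv Pu Pv.
have [Wr Wi] := bounded_lipschitz_wave _ _ k Hu Hv.
have [Qr Qi] := periodic_wave _ _ k Pu Pv.
have Tr := bounded_lipschitz_translate i h _ Wr.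
have Ti := bounded_lipschitz_translate i h _ Wi.
set C := cos (IZR (k i) * h); set S := sin (IZR (k i) * h).
have CS : S * S + C * C = 1 by exact: sin2_cos2.
have Er : fhat_re (diff (translate i h) u) (diff (translate i h) v) k =
    C * fhat_re u v k + (- S) * fhat_im u v k + (-1) * fhat_re u v k.
  (* From f(x+h) e^{-i(k,x)} = e^{i k_i h} times the wave at the translated point; C and S are the
     real and imaginary parts of e^{i k_i h}. *)
  rewrite {1}/fhat_re (_ : (fun t => _) = fun x =>
    C * wave_re u v k (translate i h x) + (- S) * wave_im u v k (translate i h x) +
    (-1) * wave_re u v k x); last first.
    apply: functional_extensionality => x.
    rewrite /diff /wave_re /wave_im kdot_translate cos_plus sin_plus -/C -/S.
    set c := cos _; set s := sin _; set a := u (translate _ _ _); set b := v (translate _ _ _).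
    transitivity ((S * S + C * C) * (a * c + b * s) - (u x * c + v x * s)); last by ring.
    rewrite CS; ring.
  rewrite integral_lin3 // !integral_translate // /fhat_re /fhat_im -/(wave_re u v k) -/(wave_im u v k).
  ring.
have Ei : fhat_im (diff (translate i h) u) (diff (translate i h) v) k =
    S * fhat_re u v k + C * fhat_im u v k + (-1) * fhat_im u v k.
  rewrite {1}/fhat_im (_ : (fun t => _) = fun x =>
    S * wave_re u v k (translate i h x) + C * wave_im u v k (translate i h x) +
    (-1) * wave_im u v k x); last first.
    apply: functional_extensionality => x.
    rewrite /diff /wave_re /wave_im kdot_translate cos_plus sin_plus -/C -/S.
    set c := cos _; set s := sin _; set a := u (translate _ _ _); set b := v (translate _ _ _).
    transitivity ((S * S + C * C) * (b * c - a * s) - (v x * c - u x * s)); last by ring.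
    rewrite CS; ring.
  rewrite integral_lin3 // !integral_translate // /fhat_re /fhat_im -/(wave_re u v k) -/(wave_im u v k).
  ring.
rewrite /fhat_sq Er Ei; set X := fhat_re u v k; set Y := fhat_im u v k.
transitivity ((1 + (S * S + C * C) - 2 * C) * (X ^ 2 + Y ^ 2)); first by ring.
by rewrite CS; ring.
Qed.

Lemma periodic_diffs {m} (i : 'I_m) (h : R) (F : pt m -> R) l :
  periodic F -> periodic (iter l (diff (translate i h)) F).
Proof.
move=> HF; elim: l => [//|l IH] x j; rewrite !diffsS IH; congr (_ - _).
rewrite -(IH (translate i h x) j); congr (iter _ _ _ _).
case: (eqVneq i j) => [<-|ij]; last by rewrite translate_upd_neq // /translate upd_neq // eq_sym.
rewrite translate_upd /translate updE upd_upd; congr (upd _ _ _); ring.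
Qed.

(** Where the cosine is nonpositive, each difference multiplies the squared modulus by 2 - 2 cos >=
    2. *)
Lemma fhat_sq_le_diffs {m} (i : 'I_m) (h : R) (u v : pt m -> R) k l :
  bounded_lipschitz u -> bounded_lipschitz v -> periodic u -> periodic v ->
  cos (IZR (k i) * h) <= 0 ->
  fhat_sq u v k <=
  fhat_sq (iter l (diff (translate i h)) u) (iter l (diff (translate i h)) v) k.
Proof.
move=> Hu Hv Pu Pv Hc; elim: l => [|l IH]; first exact: Rle_refl.
apply: Rle_trans IH _; rewrite !iterS fhat_sq_diff //;
  try exact: bounded_lipschitz_diffs; try exact: periodic_diffs.
have : 0 <= fhat_sq (iter l (diff (translate i h)) u) (iter l (diff (translate i h)) v) k.
  by apply: Rplus_le_le_0_compat; exact: pow2_ge_0.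
nra.
Qed.

(** * Real powers and the differences of e^{i lambda phi} *)

Lemma Rpower_gt0 (x a : R) : 0 < Rpower x a.
Proof. exact: exp_pos. Qed.

Lemma exp_monotone (x y : R) : x <= y -> exp x <= exp y.
Proof. by case=> [/exp_increasing /Rlt_le|->] //; exact: Rle_refl. Qed.

Lemma Rpower_le_anti (x a b : R) : 0 < x <= 1 -> a <= b -> Rpower x b <= Rpower x a.
Proof.
move=> [x0 x1] ab; apply: exp_monotone.
have : ln x <= 0 by rewrite -ln_1; apply: ln_le.
nra.
Qed.

Lemma Rpower_neg_anti (x y a : R) : 0 < x <= y -> a <= 0 -> Rpower y a <= Rpower x a.
Proof.
move=> [x0 xy] a0; apply: exp_monotone.
have : ln x <= ln y by apply: ln_le.
nra.
Qed.

(** l -> min(l,s) is subadditive and nondecreasing, and powers of eta <= 1 decrease in the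
    exponent. *)
Lemma gauge_Rpower_Rmin (eta s : R) : 0 < eta <= 1 -> 0 <= s ->
  gauge (fun l => Rpower eta (Rmin (INR l) s)).
Proof.
move=> He s0; split => [|l|l k|l k].
- by rewrite Rmin_left // Rpower_O //; case: He.
- exact/Rlt_le/Rpower_gt0.
- rewrite -Rpower_plus; apply: Rpower_le_anti => //; rewrite plus_INR.
  have := pos_INR l; have := pos_INR k.
  by rewrite /Rmin; do 3 case: Rle_dec; lra.
- apply: Rpower_le_anti => //; rewrite plus_INR.
  have := pos_INR l; have := pos_INR k.
  by rewrite /Rmin; do 2 case: Rle_dec; lra.
Qed.

Lemma diffs_exp_le {m} (nu : nat) (alpha : R) (phi : pt m -> R) :
  0 <= alpha <= 1 -> 1 <= INR nu + alpha -> C_nu_alpha m nu alpha phi ->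
  exists A, 0 <= A /\ forall (i : 'I_m) (h lambda eta : R),
    0 < h -> 1 <= Rabs lambda -> Rabs lambda * h <= eta -> eta <= 1 -> forall x,
    Rabs (iter nu.+1 (diff (translate i h)) (fun t => cos (lambda * phi t)) x)
      <= A * Rpower eta (INR nu + alpha) /\
    Rabs (iter nu.+1 (diff (translate i h)) (fun t => sin (lambda * phi t)) x)
      <= A * Rpower eta (INR nu + alpha).
Proof.
move=> Ha Hs Hphi; have [B [B0 HB]] := C_nu_alpha_diffs_le nu alpha phi Ha Hphi.
set s := INR nu + alpha in Hs HB *.
have [A [A0 HA]] := dbounded_cos_sin (pt m) nu.+1 B B0.
exists A; split => // i h lambda eta h0 l1 le e1 x.
have lh : 0 < Rabs lambda * h by apply: Rmult_lt_0_compat; lra.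
have Hg : gauge (fun l => Rpower eta (Rmin (INR l) s)) by apply: gauge_Rpower_Rmin; lra.
have [|Hc Hd] := HA (translate i h) _ 0%nat (fun t => lambda * phi t) Hg.
  move=> l hl1 hl2 y; rewrite diffs_scal Rabs_mult addn0.
  have hb := HB i h h0 l hl1 hl2 y.
  set mu := Rmin (INR l) s in hb *.
  have mu1 : 1 <= mu.
    by apply: Rmin_glb => //; have := le_INR _ _ (elimT leP hl1).
  (* The single factor |lambda| is raised to the power mu >= 1 so that it can be merged with
     h^mu. *)
  have llm : Rabs lambda <= Rpower (Rabs lambda) mu.
    rewrite -{1}(Rpower_1 (Rabs lambda)); last lra.
    by apply: Rle_Rpower.
  have step : Rpower (Rabs lambda) mu * Rpower h mu <= Rpower eta mu.
    rewrite Rpower_mult_distr //; last lra.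
    by apply: Rle_Rpower_l; [lra | split; lra].
  apply: (Rle_trans _ (Rpower (Rabs lambda) mu * (B * Rpower h mu))).
    by apply: Rmult_le_compat => //; exact: Rabs_pos.
  rewrite -Rmult_assoc (Rmult_comm _ B) Rmult_assoc.
  exact: Rmult_le_compat_l.
have E : Rmin (INR (nu.+1 + 0)) s = s.
  by rewrite addn0 Rmin_right // S_INR /s; lra.
split; first by have := Hc nu.+1 isT (leqnn _) x; rewrite E.
by have := Hd nu.+1 isT (leqnn _) x; rewrite E.
Qed.

(** Order l = 1 of the difference bound has exponent min(1,s) = 1, which makes phi Lipschitz along
    coordinates. *)
Lemma bounded_lipschitz_exp {m} (nu : nat) (alpha lambda : R) (phi : pt m -> R) :
  0 <= alpha <= 1 -> 1 <= INR nu + alpha -> C_nu_alpha m nu alpha phi ->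
  bounded_lipschitz (fun t => cos (lambda * phi t)) /\
  bounded_lipschitz (fun t => sin (lambda * phi t)).
Proof.
move=> Ha Hs Hphi; have [B [B0 HB]] := C_nu_alpha_diffs_le nu alpha phi Ha Hphi.
have up (x : pt m) i a b : a < b -> Rabs (phi (upd x i b) - phi (upd x i a)) <= B * (b - a).
  move=> ab; have := HB i (b - a) ltac:(lra) 1%nat isT isT (upd x i a).
  rewrite /= /diff translate_upd Rmin_left // Rpower_1; last lra.
  by rewrite (_ : a + (b - a) = b); last ring.
have lip : coord_lipschitz (Rabs lambda * B) (fun t => lambda * phi t).
  move=> x i a b; rewrite -Rmult_minus_distr_l Rabs_mult Rmult_assoc.
  apply: Rmult_le_compat_l; first exact: Rabs_pos.
  case: (Rtotal_order a b) => [ab|[->|ba]].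
  - by rewrite Rabs_minus_sym (Rabs_minus_sym a) (Rabs_pos_eq (b - a)); [exact: up | lra].
  - rewrite !Rminus_diag Rabs_R0; lra.
  - by rewrite (Rabs_pos_eq (a - b)); [exact: up | lra].
have K0 : 0 <= Rabs lambda * B by apply: Rmult_le_pos => //; exact: Rabs_pos.
by split; [exact: bounded_lipschitz_cos lip | exact: bounded_lipschitz_sin lip].
Qed.

(** * The l^2 mass of a dyadic shell *)

Definition separated {m} {I : Type} (k : I -> 'I_m -> Z) : Prop :=
  forall c d, c <> d -> exists i, k c i <> k d i.

Lemma bessel_sup {m} (I : finType) (P : pred I) (k : I -> 'I_m -> Z) (u v : pt m -> R) (M : R) :
  separated k -> bounded_lipschitz u -> bounded_lipschitz v ->
  (forall x, u x ^ 2 + v x ^ 2 <= M) ->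
  \big[Rplus/0]_(c | P c) fhat_sq u v (k c) <= M.
Proof.
move=> Hk Hu Hv HM; have E0 : 0 < (2 * PI) ^ m by apply: pow_lt; exact: two_pi_gt0.
apply: (Rmult_le_reg_l _ _ _ E0); rewrite -big_filter.
apply: (Rle_trans _ (integral_T (fun x => u x ^ 2 + v x ^ 2))).
  apply: bessel => // [|c d _ _ cd]; first by rewrite filter_uniq // index_enum_uniq.
  by apply: Hk; exact/eqP.
rewrite -integral_const; apply: integral_le => //; last exact: bounded_lipschitz_const.
by apply: bounded_lipschitz_add; exact: bounded_lipschitz_pow2.
Qed.

(** A term may be counted for several j, which is harmless for nonnegative [F]. It splits a shell
    into m slabs according to a coordinate in which the frequency is large. *)
Lemma sum_le_cover (I J : finType) (P : pred I) (Q : I -> pred J) (F : I -> R) :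
  (forall c, P c -> 0 <= F c) -> (forall c, P c -> exists j, Q c j) ->
  \big[Rplus/0]_(c | P c) F c <=
  \big[Rplus/0]_j \big[Rplus/0]_(c | P c && Q c j) F c.
Proof.
move=> F0 HQ; rewrite -(exchange_big_dep predT) //=.
apply: sum_le => c Pc; have [j Qj] := HQ c Pc.
rewrite (bigD1 j) //=.
have : 0 <= \big[Rplus/0]_(i | Q c i && (i != j)) F c by apply: sum_ge0 => i _; exact: F0.
lra.
Qed.

Lemma cos_le0_abs (x : R) : PI / 2 <= Rabs x <= PI -> cos x <= 0.
Proof.
move=> H; have -> : cos x = cos (Rabs x).
  by rewrite /Rabs; case: Rcase_abs => _ //; rewrite cos_neg.
have pi0 := PI_RGT_0; apply: cos_le_0; lra.
Qed.

Lemma shell_bessel {m} (nu : nat) (alpha : R) (phi : pt m -> R) :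
  0 <= alpha <= 1 -> 1 <= INR nu + alpha -> C_nu_alpha m nu alpha phi ->
  exists A, 0 < A /\ forall (lambda eta M : R) (I : finType) (P : pred I)
      (Q : I -> pred 'I_m) (k : I -> 'I_m -> Z),
    1 <= Rabs lambda -> 0 < M -> 4 * Rabs lambda <= eta * M -> eta <= 1 -> separated k ->
    (forall c, P c -> exists j, Q c j) ->
    (forall c j, P c -> Q c j -> M / 2 <= Rabs (IZR (k c j)) <= M) ->
    \big[Rplus/0]_(c | P c)
      fhat_sq (fun t => cos (lambda * phi t)) (fun t => sin (lambda * phi t)) (k c)
    <= A * Rpower eta (INR nu + alpha) ^ 2.
Proof.
move=> Ha Hs Hphi; have [A [A0 HA]] := diffs_exp_le nu alpha phi Ha Hs Hphi.
have m0 := pos_INR m.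
have A20 : 0 <= INR m * (2 * A ^ 2) by apply: Rmult_le_pos => //; have := pow2_ge_0 A; lra.
(* One contribution 2 A^2 (cosine and sine parts) for each of the m slabs; the summand 1 makes the
   constant strictly positive. *)
exists (INR m * (2 * A ^ 2) + 1); split; first lra.
move=> lambda eta M I P Q k l1 M0 lM e1 Hk HPQ HQ.
set u := fun t => cos _; set v := fun t => sin _; set r := Rpower _ _.
have [Hu Hv] : bounded_lipschitz u /\ bounded_lipschitz v by exact: bounded_lipschitz_exp Hphi.
have HP := proj1 Hphi.
have Pu : periodic u by move=> x i; rewrite /u HP.
have Pv : periodic v by move=> x i; rewrite /v HP.
have pi0 := PI_RGT_0; have pi4 := PI_4.
(* With this step, M/2 <= |k_i| <= M means pi/2 <= |k_i h| <= pi, where the cosine is nonpositive.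
   The factor 4 in the hypothesis on eta absorbs pi. *)
set h := PI / M; have h0 : 0 < h by apply: Rdiv_lt_0_compat.
have lh : Rabs lambda * h <= eta.
  apply: (Rmult_le_reg_r M) => //; rewrite /h.
  rewrite (_ : Rabs lambda * (PI / M) * M = Rabs lambda * PI); last by field; lra.
  nra.
apply: (Rle_trans _ (INR m * (2 * A ^ 2 * r ^ 2))); last by have := pow2_ge_0 r; nra.
rewrite -[m in INR m](card_ord m).
rewrite -(sum_const _ predT).
apply: Rle_trans; first apply: (sum_le_cover _ _ P Q) => // c _.
  by apply: Rplus_le_le_0_compat; exact: pow2_ge_0.
apply: sum_le => i _.
pose D := diff (translate i h).
apply: (Rle_trans _ (\big[Rplus/0]_(c | P c && Q c i) fhat_sq (iter nu.+1 D u) (iter nu.+1 D v) (k c))).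
  apply: sum_le => c /andP [Pc Qc]; apply: fhat_sq_le_diffs => //.
  apply: cos_le0_abs; rewrite Rabs_mult (Rabs_pos_eq h); last lra.
  have [k1 k2] := HQ c i Pc Qc.
  rewrite (_ : PI / 2 = M / 2 * h); last by rewrite /h; field; lra.
  rewrite (_ : PI = M * h); last by rewrite /h; field; lra.
  by split; apply: Rmult_le_compat_r => //; lra.
apply: bessel_sup => // [||x]; try exact: bounded_lipschitz_diffs.
have [B1 B2] := HA i h lambda eta h0 l1 lh e1 x.
rewrite (_ : 2 * A ^ 2 * r ^ 2 = (A * r) ^ 2 + (A * r) ^ 2); last by ring.
by apply: Rplus_le_compat; rewrite -pow2_abs; apply: pow_incr; split => //; exact: Rabs_pos.
Qed.

(* a^p <= a^2 T^(p-2) + T^p for every threshold T; T^2 = S / n balances the two sums. *)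
Lemma sum_rpow_le (I : finType) (P : pred I) (a : I -> R) (p S n : R) :
  0 < S -> 0 < n -> 0 < p < 2 -> (forall c, P c -> 0 <= a c) ->
  \big[Rplus/0]_(c | P c) a c ^ 2 <= S -> INR #|P| <= n ->
  \big[Rplus/0]_(c | P c) rpow (a c) p <= 2 * Rpower S (p / 2) * Rpower n (1 - p / 2).
Proof.
move=> S0 n0 Hp Ha HS Hn.
have Sn0 : 0 < S / n by apply: Rdiv_lt_0_compat.
set T := Rpower (S / n) (/ 2); have T0 : 0 < T by exact: Rpower_gt0.
apply: (Rle_trans _ (\big[Rplus/0]_(c | P c) (Rpower T (p - 2) * a c ^ 2 + Rpower T p))).
  apply: sum_le => c Pc; rewrite /rpow.
  have := Rpower_gt0 T p; have := Rpower_gt0 T (p - 2); have := pow2_ge_0 (a c).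
  case: Rle_dec => a0 h1 h2 h3; first by nra.
  (* Up to T the term T^p dominates; above T, a^(p-2) <= T^(p-2) because p < 2. *)
  case: (Rle_lt_dec (a c) T) => aT.
    have : Rpower (a c) p <= Rpower T p by apply: Rle_Rpower_l; lra.
    nra.
  rewrite {1}(_ : p = p - 2 + INR 2); last by rewrite /=; ring.
  rewrite Rpower_plus Rpower_pow; last lra.
  have : Rpower (a c) (p - 2) <= Rpower T (p - 2) by apply: Rpower_neg_anti; lra.
  nra.
rewrite big_split /= sum_scal sum_const.
rewrite (_ : 2 * _ * _ = Rpower T (p - 2) * S + n * Rpower T p).
  apply: Rplus_le_compat; first by apply: Rmult_le_compat_l => //; exact/Rlt_le/Rpower_gt0.
  by apply: Rmult_le_compat_r => //; exact/Rlt_le/Rpower_gt0.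
have lnT : ln T = / 2 * (ln S - ln n).
  by rewrite /T /Rpower ln_exp Rcomplements.ln_div.
have E1 : Rpower T (p - 2) * S = Rpower S (p / 2) * Rpower n (1 - p / 2).
  by rewrite -[X in _ * X](exp_ln S) // /Rpower lnT -!exp_plus; f_equal; field.
have E2 : n * Rpower T p = Rpower S (p / 2) * Rpower n (1 - p / 2).
  by rewrite -[X in X * _](exp_ln n) // /Rpower lnT -!exp_plus; f_equal; field.
rewrite E1 E2; ring.
Qed.

(** * Counting frequencies and summing over the shells *)

Definition cube_index {m N : nat} (c : {ffun 'I_m -> 'I_(2 * N + 1)}) : 'I_m -> Z :=
  fun j => (Z.of_nat (c j) - Z.of_nat N)%Z.

(** This is max|k_i| <= M for k = [cube_index c], written with additions to avoid truncated
    subtraction. *)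
Definition in_box {m N : nat} (M : nat) (c : {ffun 'I_m -> 'I_(2 * N + 1)}) : bool :=
  [forall i, leq (c i) (N + M) && leq N (c i + M)].

Lemma separated_cube_index (m N : nat) : separated (@cube_index m N).
Proof.
move=> c d cd; case: (pickP (fun i => c i != d i)) => [i /eqP ci|H].
  exists i => E; apply: ci; apply: val_inj; rewrite /cube_index in E; simpl; lia.
by case: cd; apply/ffunP => i; apply/eqP; rewrite -[_ == _]negbK H.
Qed.

(** Each coordinate takes at most 2M + 1 values, whatever the size N of the ambient cube; this makes
    the later bounds uniform in N. *)
Lemma card_box (m N M : nat) :
  leq #|[pred c : {ffun 'I_m -> 'I_(2 * N + 1)} | in_box M c]| (expn (2 * M + 1) m).
Proof.
pose A := [pred x : 'I_(2 * N + 1) | leq x (N + M) && leq N (x + M)].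
have -> : #|[pred c : {ffun 'I_m -> 'I_(2 * N + 1)} | in_box M c]| =
          #|[pred c : {ffun 'I_m -> 'I_(2 * N + 1)} | c \in ffun_on A]|.
  apply: eq_card => c; rewrite [LHS]inE [RHS]inE /=; apply/forallP/ffun_onP => H i; exact: H.
rewrite card_ffun_on card_ord.
have hA : leq #|A| (2 * M + 1).
  rewrite [X in leq _ X]addn1; pose g (x : 'I_(2 * N + 1)) : 'I_(2 * M).+1 := inord (x + M - N).
  rewrite -[X in leq _ X]card_ord; apply: (leq_card_in g) => x y.
  rewrite !inE => /andP [/leP x1 /leP x2] /andP [/leP y1 /leP y2] /(f_equal val) /=.
  rewrite !inordK; first by move=> E; apply: val_inj => /=; lia.
  - by apply/leP; lia.
  - by apply/leP; lia.
by case: m => [|n]; [rewrite !expn0 | rewrite leq_exp2r].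
Qed.

Lemma INR_expn (a n : nat) : INR (expn a n) = INR a ^ n.
Proof. by elim: n => [|n IH]; rewrite ?expn0 // expnS mult_INR IH. Qed.

Lemma fhat_abs_sq {m} (u v : pt m -> R) k : fhat_abs u v k ^ 2 = fhat_sq u v k.
Proof.
by apply: pow2_sqrt; apply: Rplus_le_le_0_compat; exact: pow2_ge_0.
Qed.

(** The Hoelder-type bound with S = A 2^(-2js) and n = (3 * 2^j L)^m, where 3 comes from 2x + 1 <=
    3x for x = 2^j L >= 1. Collecting the powers of 2^j gives the ratio of the geometric series. *)
Lemma shell_sum_le (I : finType) (P : pred I) (a : I -> R) (m : nat) (p s A : R) (j L : nat) :
  1 <= p < 2 -> 0 < A -> leq 1 L -> (forall c, P c -> 0 <= a c) ->
  \big[Rplus/0]_(c | P c) a c ^ 2 <= A * Rpower ((/ 2) ^ j) s ^ 2 ->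
  leq #|P| (expn (2 * (expn 2 j * L) + 1) m) ->
  \big[Rplus/0]_(c | P c) rpow (a c) p <=
  2 * Rpower A (p / 2) * Rpower 3 (INR m * (1 - p / 2)) *
    Rpower (INR L) (INR m * (1 - p / 2)) * Rpower 2 (INR m * (1 - p / 2) - s * p) ^ j.
Proof.
move=> Hp A0 L1 Ha HS Hn.
have L0 : 1 <= INR L by exact: (le_INR 1 L (elimT leP L1)).
have q0 : 0 < (/ 2) ^ j by apply: pow_lt; lra.
have p2 : 1 <= 2 ^ j by apply: pow_R1_Rle; lra.
have q1 : 1 <= 2 ^ j * INR L by rewrite -(Rmult_1_l 1); apply: Rmult_le_compat; lra.
have n0 : 0 < 3 * (2 ^ j * INR L) by lra.
have Hn' : INR #|P| <= (3 * (2 ^ j * INR L)) ^ m.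
  apply: (Rle_trans _ _ _ (le_INR _ _ (elimT leP Hn))).
  rewrite INR_expn; apply: pow_incr; split; first exact: pos_INR.
  rewrite plus_INR !mult_INR INR_expn -[INR 2]/2 -[INR 1]/1; lra.
have S0 : 0 < A * Rpower ((/ 2) ^ j) s ^ 2.
  by apply: Rmult_lt_0_compat => //; apply: pow_lt; exact: Rpower_gt0.
apply: (Rle_trans _ _ _ (sum_rpow_le _ P a p _ _ S0 (pow_lt _ m n0) _ Ha HS Hn')); first lra.
apply: Req_le.
have r2 : 0 < Rpower ((/ 2) ^ j) s ^ 2 by apply: pow_lt; exact: Rpower_gt0.
rewrite -(Rpower_mult_distr A) //.
rewrite -(Rpower_pow m) // !Rpower_mult -(Rpower_mult_distr 3) //; try nra.
rewrite -(Rpower_mult_distr (2 ^ j)) //; try lra.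
have E1 : Rpower (Rpower ((/ 2) ^ j) s ^ 2) (p / 2) = Rpower 2 (- (INR j * (s * p))).
  rewrite -(Rpower_pow 2); last exact: Rpower_gt0.
  rewrite -(Rpower_pow j) ; last lra.
  rewrite -{1}(Rpower_1 2) -?Rpower_Ropp ?Rpower_mult; last lra.
  by f_equal => /=; field.
have E2 : Rpower (2 ^ j) (INR m * (1 - p / 2)) = Rpower 2 (INR j * (INR m * (1 - p / 2))).
  by rewrite -(Rpower_pow j) ?Rpower_mult //; lra.
have E3 : Rpower 2 (INR m * (1 - p / 2) - s * p) ^ j =
    Rpower 2 (- (INR j * (s * p))) * Rpower 2 (INR j * (INR m * (1 - p / 2))).
  rewrite -Rpower_plus -(Rpower_pow j); last exact: Rpower_gt0.
  by rewrite Rpower_mult; f_equal; ring.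
rewrite E1 E2 E3; ring.
Qed.

(* Frequencies with max|k_i| <= L are controlled by Bessel alone; the dyadic shells
   2^j L < max|k_i| <= 2^(j+1) L by the finite differences of step pi / (2^(j+1) L). *)
Lemma cube_sum_le {m} (p alpha : R) (nu : nat) (phi : pt m -> R) :
  1 <= p < 2 -> 0 <= alpha <= 1 -> C_nu_alpha m nu alpha phi ->
  1 <= INR nu + alpha -> INR m * (/ p - / 2) < INR nu + alpha ->
  exists C, 0 <= C /\ forall (lambda : R) (L N : nat),
    1 <= Rabs lambda -> 4 * Rabs lambda <= INR L ->
    cube_sum p (fun t => cos (lambda * phi t)) (fun t => sin (lambda * phi t)) N <=
    C * Rpower (INR L) (INR m * (1 - p / 2)).
Proof.
move=> Hp Ha Hphi Hs1 Hs; have [A [A0 HA]] := shell_bessel nu alpha phi Ha Hs1 Hphi.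
set s := INR nu + alpha in HA Hs Hs1.
set b := INR m * (1 - p / 2).
set q := Rpower 2 (b - s * p).
have q0 : 0 < q by exact: Rpower_gt0.
have q1 : q < 1.
  rewrite -(Rpower_O 2); last lra.
  apply: Rpower_lt; first lra.
  (* b = m(1/p - 1/2) p, so the smoothness hypothesis says b < s p, that is, q < 1. *)
  rewrite (_ : b = INR m * (/ p - / 2) * p); last by rewrite /b; field; lra.
  nra.
(* A + 1 serves both the shells, which need A, and the central box, where Bessel gives 1. *)
set D := 2 * Rpower (A + 1) (p / 2) * Rpower 3 b.
have D0 : 0 < D by do 2 (apply: Rmult_lt_0_compat; last exact: Rpower_gt0); lra.
exists (D / (1 - q)); split; first by apply/Rlt_le/Rdiv_lt_0_compat; lra.
move=> lambda L N l1 lL.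
set u := fun t => cos _; set v := fun t => sin _.
have [Hu Hv] : bounded_lipschitz u /\ bounded_lipschitz v by exact: bounded_lipschitz_exp Hphi.
have L1 : leq 1 L by apply/leP; apply: INR_le => /=; lra.
set W := Rpower (INR L) b; have W0 : 0 < W by exact: Rpower_gt0.
pose a (c : {ffun 'I_m -> 'I_(2 * N + 1)}) := fhat_abs u v (cube_index c).
have a0 c : 0 <= a c by exact: sqrt_pos.
have aE P : \big[Rplus/0]_(c | P c) a c ^ 2 = \big[Rplus/0]_(c | P c) fhat_sq u v (cube_index c).
  by apply: eq_bigr => c _; exact: fhat_abs_sq.
pose M j := (expn 2 j * L)%nat.
have MS j : M j.+1 = (2 * M j)%nat by rewrite /M expnS mulnA.
have M0 j : leq 1 (M j) by rewrite muln_gt0 expn_gt0 L1.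
have shell j (P : pred _) : (forall c, P c -> in_box (M j) c) ->
    \big[Rplus/0]_(c | P c) a c ^ 2 <= (A + 1) * Rpower ((/ 2) ^ j) s ^ 2 ->
    \big[Rplus/0]_(c | P c) rpow (a c) p <= D * W * q ^ j.
  move=> Pb HP; apply: shell_sum_le => //; first lra.
  apply: leq_trans (card_box m N (M j)); apply: subset_leq_card.
  by apply/subsetP => c Pc; rewrite inE; exact: Pb.
have main J : \big[Rplus/0]_(c : {ffun 'I_m -> 'I_(2 * N + 1)} | in_box (M J) c) rpow (a c) p <=
    D * W * ((1 - q ^ J.+1) / (1 - q)).
  elim: J => [|J IH].
    apply: (Rle_trans _ (D * W * q ^ 0)); last by apply: Req_le; rewrite /=; field; lra.
    apply: shell => // ; rewrite aE.
    have -> : (A + 1) * Rpower ((/ 2) ^ 0) s ^ 2 = A + 1.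
      by rewrite /Rpower /= ln_1 Rmult_0_r exp_0; ring.
    apply: (Rle_trans _ 1); last lra.
    apply: bessel_sup => //; first exact: separated_cube_index.
    by move=> x; have := sin2_cos2 (lambda * phi x); rewrite /Rsqr /u /v; lra.
  rewrite (bigID (in_box (M J))) /=.
  have -> : D * W * ((1 - q * (q * q ^ J)) / (1 - q)) =
      D * W * ((1 - q ^ J.+1) / (1 - q)) + D * W * q ^ J.+1 by rewrite /=; field; lra.
  apply: Rplus_le_compat.
    apply: Rle_trans IH.
    rewrite [X in _ <= X](bigID (in_box (M J.+1))) /=.
    rewrite (eq_bigl (fun c => in_box (M J) c && in_box (M J.+1) c)); last by move=> c; rewrite andbC.
    rewrite -[X in X <= _]Rplus_0_r; apply: Rplus_le_compat_l.
    apply: sum_ge0 => c _; rewrite /rpow; case: Rle_dec => _; [lra | exact/Rlt_le/Rpower_gt0].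
  apply: shell => [c /andP [] //|]; rewrite aE.
  (* Selects the coordinates with |k_i| > M J, which is half of M (J + 1). *)
  pose Q (c : {ffun 'I_m -> 'I_(2 * N + 1)}) (i : 'I_m) := ~~ (leq (c i) (N + M J) && leq N (c i + M J)).
  apply: (Rle_trans _ (A * Rpower ((/ 2) ^ J.+1) s ^ 2)); last first.
    by have := pow2_ge_0 (Rpower ((/ 2) ^ J.+1) s); lra.
  have IM : INR (M J.+1) = 2 ^ J.+1 * INR L by rewrite mult_INR INR_expn.
  have h0 : 0 < (/ 2) ^ J.+1 by apply: pow_lt; lra.
  have h1 : (/ 2) ^ J.+1 * 2 ^ J.+1 = 1.
    by rewrite -Rpow_mult_distr Rinv_l ?pow1 //; lra.
  (* Here eta = 2^-(J+1) and the outer radius is 2^(J+1) L, so their product is L >= 4 |lambda|. *)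
  apply: (HA lambda _ (INR (M J.+1)) _ _ Q) => //.
  - by apply: lt_0_INR; apply/leP; exact: M0.
  - by rewrite IM -Rmult_assoc h1 Rmult_1_l.
  - have : 1 <= 2 ^ J.+1 by apply: pow_R1_Rle; lra.
    nra.
  - exact: separated_cube_index.
  - by move=> c /andP [_]; rewrite negb_forall => /existsP.
  - move=> c i /andP [/forallP /(_ i) H1 _]; rewrite /Q MS => H2.
    rewrite -abs_IZR (_ : INR (2 * M J) / 2 = INR (M J)); last by rewrite mult_INR /=; field.
    rewrite !INR_IZR_INZ MS in H1 *; split; apply: IZR_le; rewrite /cube_index; lia.
(* The whole cube of radius N lies in the box of radius 2^N L, so J = N shells suffice; the
   geometric sum is bounded independently of N. *)
apply: (Rle_trans _ (D * W * ((1 - q ^ N.+1) / (1 - q)))).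
  apply: Rle_trans (main N); apply: Req_le; apply: eq_bigl => c; symmetry.
  have MN : leq N (M N).
    by apply: leq_trans (ltnW (ltn_expl N (isT : leq 2 2))) _; rewrite leq_pmulr.
  move: (M N) MN => MN hMN; apply/forallP => i; move: (nat_of_ord (c i)) (ltn_ord (c i)) => ci hci; lia.
rewrite (_ : D / (1 - q) * W = D * W * (1 / (1 - q))); last by field; lra.
apply: Rmult_le_compat_l; first by apply: Rmult_le_pos; lra.
apply: Rmult_le_compat_r; first by apply/Rlt_le/Rinv_0_lt_compat; lra.
have : 0 < q ^ N.+1 by apply: pow_lt.
lra.
Qed.

(* ||e^{i lambda phi}||_{A_p} = O(|lambda|^{m(1/p-1/2)}) as |lambda| -> oo *)
Theorem theorem3 (m : nat) (p alpha : R) (nu : nat) (phi : pt m -> R) :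
  leq 1 m ->
  1 <= p -> p < 2 ->
  0 <= alpha -> alpha <= 1 ->
  C_nu_alpha m nu alpha phi ->
  1 <= INR nu + alpha ->
  INR m * (/ p - / 2) < INR nu + alpha ->
  exists C Lambda0 : R, forall lambda : R, Lambda0 <= Rabs lambda ->
    Rbar_le
      (Ap_norm p (fun t => cos (lambda * phi t)) (fun t => sin (lambda * phi t)))
      (Finite (C * rpow (Rabs lambda) (INR m * (/ p - / 2)))).
Proof.
move=> _ p1 p2 a0 a1 Hphi Hs1 Hs.
have [C [C0 HC]] := cube_sum_le p alpha nu phi (conj p1 p2) (conj a0 a1) Hphi Hs1 Hs.
set b := INR m * (1 - p / 2) in HC.
(* L = [up (4 * Rabs lambda)] is at most 4 |lambda| + 1 <= 5 |lambda|. *)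
set C' := C * Rpower 5 b.
have C'0 : 0 <= C' by apply: Rmult_le_pos => //; exact/Rlt_le/Rpower_gt0.
have b0 : 0 <= b by apply: Rmult_le_pos; [exact: pos_INR | lra].
(* The p-th root turns the exponent b into b/p = m(1/p - 1/2); C' + 1 keeps the base of [Rpower]
   positive. *)
exists (Rpower (C' + 1) (/ p)), 1 => lambda l1.
have [up1 up2] := archimed (4 * Rabs lambda).
pose L := Z.to_nat (up (4 * Rabs lambda)).
have LE : INR L = IZR (up (4 * Rabs lambda)).
  by rewrite INR_IZR_INZ Z2Nat.id //; apply: le_IZR; lra.
have bound N : cube_sum p (fun t => cos (lambda * phi t)) (fun t => sin (lambda * phi t)) N <=
    (C' + 1) * Rpower (Rabs lambda) b.
  apply: (Rle_trans _ _ _ (HC lambda L N l1 _)); first lra.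
  apply: (Rle_trans _ (C' * Rpower (Rabs lambda) b)).
    rewrite /C' Rmult_assoc; apply: Rmult_le_compat_l => //.
    rewrite Rpower_mult_distr; [|lra|lra].
    by apply: Rle_Rpower_l => //; lra.
  apply: Rmult_le_compat_r; [exact/Rlt_le/Rpower_gt0 | lra].
rewrite /Ap_norm; set E := fun r => _.
have [ub lub] := Lub_Rbar_correct E.
have H : Rbar_le (Lub_Rbar E) (Finite ((C' + 1) * Rpower (Rabs lambda) b)).
  by apply: lub => x [N ->]; exact: bound.
(* The bound excludes +oo, and -oo lies below everything. *)
case: (Lub_Rbar E) H => [x||] //= H.
have l0 : 0 < Rpower (Rabs lambda) b by exact: Rpower_gt0.
rewrite [rpow (Rabs lambda) _]/rpow; case: Rle_dec => [|_]; first lra.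
have -> : Rpower (C' + 1) (/ p) * Rpower (Rabs lambda) (INR m * (/ p - / 2)) =
    Rpower ((C' + 1) * Rpower (Rabs lambda) b) (/ p).
  rewrite -Rpower_mult_distr ?Rpower_mult; [|lra|done].
  by do 2 f_equal; rewrite /b; field; lra.
rewrite /rpow; case: Rle_dec => [_|x0]; first exact/Rlt_le/Rpower_gt0.
apply: Rle_Rpower_l; last by split; [lra | exact: H].
by apply/Rlt_le/Rinv_0_lt_compat; lra.
Qed.
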